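(* Let $(X,\rho,\mu)$ be a $K$-doubling metric measure space, $(M,d)$ a complete metric space and $Q\ge1$ an integer. (a) If $\mathcal D$ is a differentiably complete $X$-distribution for $M$, then every function $f\colon X\to\mathcal A_Q(M)$ is a.e. $\mathcal D^Q$-differentiable on $A_f$. (b) If $\mathcal D$ is a differentiably complete approximate $X$-distribution for $M$, then every function $f\colon X\to\mathcal A_Q(M)$ is a.e. approximately $\mathcal D^Q$-differentiable on $A_f^\mu$.
   Context: A $K$-doubling metric measure space ($K>0$) is a triple $(X,\rho,\mu)$ where $(X,\rho)$ is a complete separable metric space and $\mu$ a Borel-regular outer measure with $0<\mu(B_{2r}(x))\le K\mu(B_r(x))<+\infty$. A set $E\ni x$ is a $\mu$-neighborhood of $x$ if there is a Borel $B\subseteq E$ with $\lim_{r\to0^+}\mu(B_r(x)\setminus B)/\mu(B_r(x))=0$; $\mu\text{-}\lim$, $\mu\text{-}\limsup$ are limits along $\mu$-neighborhoods ($\mu\text{-}\limsup_{y\in A,y\to x}g(y)=\inf_U\sup_{y\in U\cap A\setminus\{x\}}g(y)$), and $x$ is a $\mu$-accumulation point of $A$ if $A\cap U\setminus\{x\}\ne\emptyset$ for all $\mu$-neighborhoods $U$. $\mathcal A_Q(M)$ is the set of measures $\sum_{i=1}^Q[\![P_i]\!]$ with metric $\mathcal G(\sum_i[\![A_i]\!],\sum_i[\![B_i]\!])=\min_\sigma\sqrt{\sum_i d(A_i,B_{\sigma(i)})^2}$ over permutations $\sigma$. For a complete metric space $(N,e)$, germs at $(x,P)\in X\times N$ are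 classes $[F]$ of Lipschitz $F\colon B\to N$ with $F(x)=P$, where for an $X$-distribution $B$ is a metric neighborhood of $x$ and $F\sim G\iff\lim_{y\to x}e(F,G)/\rho(y,x)=0$, and for an approximate $X$-distribution $B$ is a $\mu$-neighborhood of $x$ and $F\sim G\iff\mu\text{-}\lim_{y\to x}e(F,G)/\rho(y,x)=0$; an (approximate) $X$-distribution $\mathcal E$ for $N$ is any set of such germs, $\mathcal E_{x,P}$ those at $(x,P)$. For $f\colon A\to N$: $f$ is $\mathcal E$-differentiable at an accumulation point $x\in A$ of $A$ if some $[F]\in\mathcal E_{x,f(x)}$ has $\lim_{y\in A,y\to x}e(f(y),F(y))/\rho(y,x)=0$; approximately $\mathcal E$-differentiable at a $\mu$-accumulation point $x\in A$ if the same holds with $\mu\text{-}\lim$. $A_f$ (resp. $A_f^\mu$) is the set of accumulation (resp. $\mu$-accumulation) points $x\in A$ with $\limsup$ (resp. $\mu\text{-}\limsup$) of $e(f(y),f(x))/\rho(y,x)$, $y\in A$, $y\to x$, finite. ''a.e. (approximately) $\mathcal E$-differentiable on $A_f$ (resp. $A_f^\mu$)'' means at $\mu$-a.e. point of every $\mu$-measurable subset. $\mathcal E$ is differentiably complete if for every nonempty closed $C\subseteq X$ and Lipschitz $g\colon C\to N$, $g$ is a.e. approximately $\mathcal E$-differentiable on $A_g^\mu$. $\mathcal D^Q$: for $\mathbf P=\sum_i[\![P_i]\!]$, $[\mathbf F]\in\mathcal D^Q_{x_0,\mathbf P}$ iff there exist $[F_i]\in\mathcal D_{x_0,P_i}$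 with $\mathbf F(x)=\sum_{i=1}^Q[\![F_i(x)]\!]$ on a Borel neighborhood (a Borel $\mu$-neighborhood in the approximate case) of $x_0$, and $P_i=P_j\Rightarrow[F_i]=[F_j]$. *)

(* Defs.v *)
From Stdlib Require Import Reals.
From mathcomp Require Import ssreflect ssrfun ssrbool eqtype ssrnat seq choice.
From mathcomp Require Import fintype fingroup perm.
From Coquelicot Require Import Rbar.

Set Implicit Arguments.
Unset Strict Implicit.
Open Scope R_scope.

Definition is_metric (X : Type) (rho : X -> X -> R) : Prop :=
  (forall x y, 0 <= rho x y) /\
  (forall x y, rho x y = 0 <-> x = y) /\
  (forall x y, rho x y = rho y x) /\
  (forall x y z, rho x z <= rho x y + rho y z).

Definition ball (X : Type) (rho : X -> X -> R) (x : X) (r : R) : X -> Prop :=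
  fun y => rho x y < r.

Definition cauchy_seq (X : Type) (rho : X -> X -> R) (u : nat -> X) : Prop :=
  forall eps, 0 < eps -> exists N : nat,
    forall m n : nat, (N <= m)%nat -> (N <= n)%nat -> rho (u m) (u n) < eps.

Definition seq_converges (X : Type) (rho : X -> X -> R) (u : nat -> X) (l : X) : Prop :=
  forall eps, 0 < eps -> exists N : nat, forall n : nat, (N <= n)%nat -> rho (u n) l < eps.

Definition complete_space (X : Type) (rho : X -> X -> R) : Prop :=
  forall u, cauchy_seq rho u -> exists l, seq_converges rho u l.

Definition separable_space (X : Type) (rho : X -> X -> R) : Prop :=
  exists D : X -> Prop,
    (exists g : X -> nat, forall a b, D a -> D b -> g a = g b -> a = b) /\
    (forall x eps, 0 < eps -> exists y, D y /\ rho x y < eps).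

Definition open_set (X : Type) (rho : X -> X -> R) (U : X -> Prop) : Prop :=
  forall x, U x -> exists r, 0 < r /\ forall y, ball rho x r y -> U y.

Definition closed_set (X : Type) (rho : X -> X -> R) (C : X -> Prop) : Prop :=
  open_set rho (fun x => ~ C x).

Definition sigma_algebra (X : Type) (S : (X -> Prop) -> Prop) : Prop :=
  S (fun _ => True) /\
  (forall A, S A -> S (fun x => ~ A x)) /\
  (forall A : nat -> X -> Prop, (forall n, S (A n)) -> S (fun x => exists n, A n x)).

Definition borel (X : Type) (rho : X -> X -> R) (A : X -> Prop) : Prop :=
  forall S : (X -> Prop) -> Prop, sigma_algebra S ->
    (forall U, open_set rho U -> S U) -> S A.

Definition metric_nbhd (X : Type) (rho : X -> X -> R) (x : X) (B : X -> Prop) : Prop :=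
  B x /\ exists r, 0 < r /\ forall y, ball rho x r y -> B y.

Fixpoint psum (f : nat -> Rbar) (n : nat) : Rbar :=
  match n with
  | O => Finite 0
  | S k => Rbar_plus (psum f k) (f k)
  end.

Definition outer_measure (X : Type) (mu : (X -> Prop) -> Rbar) : Prop :=
  mu (fun _ => False) = Finite 0 /\
  (forall A, Rbar_le (Finite 0) (mu A)) /\
  (forall A B : X -> Prop, (forall x, A x -> B x) -> Rbar_le (mu A) (mu B)) /\
  (* countable subadditivity: mu (U_n A_n) <= sum_n mu (A_n) *)
  (forall (A : nat -> X -> Prop) (c : Rbar),
      (forall n, Rbar_le (psum (fun k => mu (A k)) n) c) ->
      Rbar_le (mu (fun x => exists n, A n x)) c).

Definition mu_measurable (X : Type) (mu : (X -> Prop) -> Rbar) (E : X -> Prop) : Prop :=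
  forall T : X -> Prop,
    mu T = Rbar_plus (mu (fun x => T x /\ E x)) (mu (fun x => T x /\ ~ E x)).

Definition borel_regular (X : Type) (rho : X -> X -> R) (mu : (X -> Prop) -> Rbar) : Prop :=
  (forall B, borel rho B -> mu_measurable mu B) /\
  (forall A : X -> Prop, exists B, borel rho B /\ (forall x, A x -> B x) /\ mu B = mu A).

Definition doubling_mms (X : Type) (rho : X -> X -> R) (mu : (X -> Prop) -> Rbar)
    (K : R) : Prop :=
  0 < K /\ is_metric rho /\ complete_space rho /\ separable_space rho /\
  outer_measure mu /\ borel_regular rho mu /\
  (forall x r, 0 < r ->
     Rbar_lt (Finite 0) (mu (ball rho x (2 * r))) /\
     Rbar_le (mu (ball rho x (2 * r))) (Rbar_mult (Finite K) (mu (ball rho x r))) /\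
     Rbar_lt (mu (ball rho x r)) p_infty).

Definition mu_nbhd (X : Type) (rho : X -> X -> R) (mu : (X -> Prop) -> Rbar)
    (x : X) (E : X -> Prop) : Prop :=
  E x /\ exists B : X -> Prop, borel rho B /\ (forall y, B y -> E y) /\
    forall eps, 0 < eps -> exists delta, 0 < delta /\
      forall r, 0 < r -> r < delta ->
        Rabs (real (mu (fun y => ball rho x r y /\ ~ B y)) / real (mu (ball rho x r)))
          < eps.

Definition nbhd (X : Type) (rho : X -> X -> R) (mu : (X -> Prop) -> Rbar)
    (approx : bool) (x : X) (B : X -> Prop) : Prop :=
  if approx then mu_nbhd rho mu x B else metric_nbhd rho x B.

Definition lim0 (X : Type) (rho : X -> X -> R) (mu : (X -> Prop) -> Rbar)
    (approx : bool) (S : X -> Prop) (x : X) (h : X -> R) : Prop :=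
  forall eps, 0 < eps -> exists U, nbhd rho mu approx x U /\
    forall y, U y -> S y -> y <> x -> Rabs (h y) < eps.

Definition limsup_finite (X : Type) (rho : X -> X -> R) (mu : (X -> Prop) -> Rbar)
    (approx : bool) (S : X -> Prop) (x : X) (h : X -> R) : Prop :=
  exists U L, nbhd rho mu approx x U /\
    forall y, U y -> S y -> y <> x -> h y <= L.

Definition accumulation (X : Type) (rho : X -> X -> R) (mu : (X -> Prop) -> Rbar)
    (approx : bool) (A : X -> Prop) (x : X) : Prop :=
  forall U, nbhd rho mu approx x U -> exists y, U y /\ A y /\ y <> x.

(* eqN is the identity of points of N (Leibniz = for a metric space M,  *)
(* multiset equality for A_Q(M) represented by Q-tuples).              *)

Record germ_rep (X N : Type) := GermRep { gdom : X -> Prop; gfun : X -> N }.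
Arguments GermRep {X N}.
Arguments gdom {X N}.
Arguments gfun {X N}.

Definition lipschitz_on (X N : Type) (rho : X -> X -> R) (e : N -> N -> R)
    (B : X -> Prop) (F : X -> N) : Prop :=
  exists L, 0 <= L /\ forall y z, B y -> B z -> e (F y) (F z) <= L * rho y z.

Definition valid_germ (X N : Type) (rho : X -> X -> R) (mu : (X -> Prop) -> Rbar)
    (e : N -> N -> R) (eqN : N -> N -> Prop) (approx : bool)
    (x : X) (P : N) (F : germ_rep X N) : Prop :=
  nbhd rho mu approx x (gdom F) /\ lipschitz_on rho e (gdom F) (gfun F) /\
  eqN (gfun F x) P.

Definition germ_equiv (X N : Type) (rho : X -> X -> R) (mu : (X -> Prop) -> Rbar)
    (e : N -> N -> R) (approx : bool) (x : X) (F G : germ_rep X N) : Prop :=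
  lim0 rho mu approx (fun y => gdom F y /\ gdom G y) x
    (fun y => e (gfun F y) (gfun G y) / rho y x).

(* A set of germs is encoded by the (saturated) set of all representatives
   of its germs: D x P F  <->  [F] in D_{x,P}. *)
Definition distribution (X N : Type) (rho : X -> X -> R) (mu : (X -> Prop) -> Rbar)
    (e : N -> N -> R) (eqN : N -> N -> Prop) (approx : bool)
    (D : X -> N -> germ_rep X N -> Prop) : Prop :=
  (forall x P F, D x P F -> valid_germ rho mu e eqN approx x P F) /\
  (forall x P F G, D x P F -> valid_germ rho mu e eqN approx x P G ->
     germ_equiv rho mu e approx x F G -> D x P G).

Definition differentiable_at (X N : Type) (rho : X -> X -> R) (mu : (X -> Prop) -> Rbar)
    (e : N -> N -> R) (approx : bool) (D : X -> N -> germ_rep X N -> Prop)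
    (A : X -> Prop) (f : X -> N) (x : X) : Prop :=
  A x /\ accumulation rho mu approx A x /\
  exists F, D x (f x) F /\
    lim0 rho mu approx (fun y => A y /\ gdom F y) x
      (fun y => e (f y) (gfun F y) / rho y x).

Definition Aset (X N : Type) (rho : X -> X -> R) (mu : (X -> Prop) -> Rbar)
    (e : N -> N -> R) (approx : bool) (A : X -> Prop) (f : X -> N) (x : X) : Prop :=
  A x /\ accumulation rho mu approx A x /\
  limsup_finite rho mu approx A x (fun y => e (f y) (f x) / rho y x).

Definition ae_differentiable (X N : Type) (rho : X -> X -> R) (mu : (X -> Prop) -> Rbar)
    (e : N -> N -> R) (approx : bool) (D : X -> N -> germ_rep X N -> Prop)
    (A : X -> Prop) (f : X -> N) : Prop :=
  forall S : X -> Prop, mu_measurable mu S ->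
    (forall x, S x -> Aset rho mu e approx A f x) ->
    exists Z : X -> Prop, mu Z = Finite 0 /\
      forall x, S x -> ~ Z x -> differentiable_at rho mu e approx D A f x.

Definition differentiably_complete (X N : Type) (rho : X -> X -> R)
    (mu : (X -> Prop) -> Rbar) (e : N -> N -> R)
    (D : X -> N -> germ_rep X N -> Prop) : Prop :=
  forall (C : X -> Prop) (g : X -> N),
    (exists x, C x) -> closed_set rho C -> lipschitz_on rho e C g ->
    ae_differentiable rho mu e true D C g.

(* Q-points A_Q(M), represented by Q-tuples up to permutation          *)

Definition AQ (M : Type) (Q : nat) : Type := 'I_Q -> M.

(* equality of the measures sum_i [[A_i]] and sum_i [[B_i]] *)
Definition eqAQ (M : Type) (Q : nat) (A B : AQ M Q) : Prop :=
  exists s : 'S_Q, forall i, A i = B (s i).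

Definition Gcost (M : Type) (d : M -> M -> R) (Q : nat) (A B : AQ M Q) (s : 'S_Q) : R :=
  foldr (fun i acc => Rsqr (d (A i) (B (s i))) + acc) 0 (enum 'I_Q).

Definition Gdist (M : Type) (d : M -> M -> R) (Q : nat) (A B : AQ M Q) : R :=
  sqrt (foldr (fun s acc => Rmin (Gcost d A B s) acc) (Gcost d A B 1%g) (enum 'S_Q)).

Definition DQ (X M : Type) (rho : X -> X -> R) (mu : (X -> Prop) -> Rbar)
    (d : M -> M -> R) (Q : nat) (approx : bool)
    (D : X -> M -> germ_rep X M -> Prop) :
    X -> AQ M Q -> germ_rep X (AQ M Q) -> Prop :=
  fun x0 P F =>
    valid_germ rho mu (@Gdist M d Q) (@eqAQ M Q) approx x0 P F /\
    exists Fs : 'I_Q -> germ_rep X M,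
      (forall i, D x0 (P i) (Fs i)) /\
      (forall i j, P i = P j -> germ_equiv rho mu d approx x0 (Fs i) (Fs j)) /\
      exists G : germ_rep X (AQ M Q),
        valid_germ rho mu (@Gdist M d Q) (@eqAQ M Q) approx x0 P G /\
        germ_equiv rho mu (@Gdist M d Q) approx x0 F G /\
        exists W : X -> Prop, borel rho W /\ nbhd rho mu approx x0 W /\
          (forall y, W y -> gdom G y /\ forall i, gdom (Fs i) y) /\
          (forall y, W y -> eqAQ (gfun G y) (fun i => gfun (Fs i) y)).

(* Main.v *)
(* The set of points where [f] is pointwise Lipschitz is exhausted by sets [E n]
   on which [f] is locally Lipschitz with a uniform constant; in the approximate
   case [E n] collects the points around which the points violating the bound
   occupy a small fraction of every small ball, so that by doubling two nearby
   points of [E n] share a good intermediate point.  On a small piece [Z] of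
   [E n] where distinct entries of [f] are uniformly separated, [f] splits into
   Q Lipschitz selections, any two of which coincide everywhere or nowhere; they
   extend to the closure [C] of [Z] because M is complete.  The extensions still
   represent [f] on [C] inside the whole exhausted set, since every point of it
   lies in a larger [E m].  Differentiable completeness applies to each selection
   and, at Lebesgue density points, the germs of the selections assemble into a
   germ of D^Q.  In the metric case the estimate passes from the density set to
   all nearby points, as a [mu]-neighborhood of x meets every ball of radius
   [eps * rho x y] about y. *)

From Stdlib Require Import Reals Lra List Classical ClassicalEpsilon.
From Stdlib Require Import FunctionalExtensionality PropExtensionality.
From mathcomp Require Import ssreflect ssrfun ssrbool eqtype ssrnat seq choice.
From mathcomp Require Import fintype fingroup perm.
From Coquelicot Require Import Rbar.
Require Import Defs.

Set Implicit Arguments.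
Unset Strict Implicit.
Open Scope R_scope.

(** * Finite Borel measures on a metric space *)

Lemma set_ext (X : Type) (A B : X -> Prop) : (forall x, A x <-> B x) -> A = B.
Proof.
move=> AB; apply: functional_extensionality => x.
exact: propositional_extensionality.
Qed.

Lemma exists_inv_lt (e : R) : 0 < e -> exists n : nat, / INR n.+1 < e.
Proof.
move=> e0; have [n [ne n0]] := archimed_cor1 e e0.
by case: n ne n0 => [_ /PeanoNat.Nat.lt_irrefl //|n ne _]; exists n.
Qed.

Lemma inv_INR_gt0 (n : nat) : 0 < / INR n.+1.
Proof. by apply: Rinv_0_lt_compat; apply: lt_0_INR; apply: PeanoNat.Nat.lt_0_succ. Qed.

Lemma inv_INR_le (n m : nat) : (n <= m)%nat -> / INR m.+1 <= / INR n.+1.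
Proof.
move=> nm; apply: Rinv_le_contravar.
  by apply: lt_0_INR; apply: PeanoNat.Nat.lt_0_succ.
by apply: le_INR; apply/leP.
Qed.

Lemma exists_INR_ge (L : R) : exists n : nat, L <= INR n.+1.
Proof.
have [n Ln] := INR_unbounded L; exists n; rewrite S_INR; lra.
Qed.

Lemma pow_half_gt0 (n : nat) : 0 < (/ 2) ^ n.
Proof. apply: pow_lt; lra. Qed.

(** * Borel sets and elementary facts about metrics *)

Section Borel.
Variables (X : Type) (rho : X -> X -> R).

Lemma borel_open (U : X -> Prop) : open_set rho U -> borel rho U.
Proof. by move=> oU S _; apply. Qed.

Lemma borel_compl (A : X -> Prop) : borel rho A -> borel rho (fun x => ~ A x).
Proof. by move=> bA S sS oS; case: (sS) => _ [h _]; apply: h; apply: bA. Qed.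

Lemma borel_cup (A : nat -> X -> Prop) :
  (forall n, borel rho (A n)) -> borel rho (fun x => exists n, A n x).
Proof. by move=> bA S sS oS; case: (sS) => _ [_ h]; apply: h => n; apply: bA. Qed.

Lemma borel_or (A B : X -> Prop) :
  borel rho A -> borel rho B -> borel rho (fun x => A x \/ B x).
Proof.
move=> bA bB.
have -> : (fun x => A x \/ B x) = (fun x => exists n : nat, (if n is O then A else B) x).
  apply: set_ext => x; split; first by case=> ?; [exists 0%nat|exists 1%nat].
  by case=> [[|n]]; [left|right].
by apply: borel_cup => -[|n].
Qed.

Lemma borel_and (A B : X -> Prop) :
  borel rho A -> borel rho B -> borel rho (fun x => A x /\ B x).
Proof.
move=> bA bB.
have -> : (fun x => A x /\ B x) = (fun x => ~ (~ A x \/ ~ B x)).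
  by apply: set_ext => x; split; [tauto|move=> h; split; apply: NNPP; tauto].
by apply: borel_compl; apply: borel_or; apply: borel_compl.
Qed.

Lemma open_True : open_set rho (fun _ => True).
Proof. by move=> x _; exists 1; split=> //; lra. Qed.

Lemma open_and (A B : X -> Prop) :
  open_set rho A -> open_set rho B -> open_set rho (fun x => A x /\ B x).
Proof.
move=> oA oB x [Ax Bx]; have [r [r0 rA]] := oA x Ax; have [s [s0 sB]] := oB x Bx.
exists (Rmin r s); split; first exact: Rmin_pos.
move=> y; rewrite /ball => xy; split; [apply: rA|apply: sB]; rewrite /ball.
  have := Rmin_l r s; lra.
have := Rmin_r r s; lra.
Qed.

Lemma closed_finite_cup (F : nat -> X -> Prop) (N : nat) :
  (forall n, closed_set rho (F n)) ->
  closed_set rho (fun x => exists n, (n < N)%nat /\ F n x).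
Proof.
move=> cF; elim: N => [|N IH].
  by move=> x _; exists 1; split; [lra|move=> y _ [n []]].
have -> : (fun x => exists n, (n < N.+1)%nat /\ F n x) =
          (fun x => (exists n, (n < N)%nat /\ F n x) \/ F N x).
  apply: set_ext => x; split.
    case=> n []; rewrite ltnS leq_eqVlt => /orP[/eqP -> ?|nN Fn]; first by right.
    by left; exists n.
  by case=> [[n [nN Fn]]|FN]; [exists n; rewrite ltnS ltnW|exists N].
rewrite /closed_set in IH *.
have -> : (fun x => ~ ((exists n, (n < N)%nat /\ F n x) \/ F N x)) =
          (fun x => ~ (exists n, (n < N)%nat /\ F n x) /\ ~ F N x).
  by apply: set_ext => x; tauto.
by apply: open_and => //; apply: cF.
Qed.

Lemma borel_closed (F : X -> Prop) : closed_set rho F -> borel rho F.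
Proof.
move=> cF; have -> : F = (fun x => ~ ~ F x).
  by apply: set_ext => x; split; [tauto|apply: NNPP].
exact: borel_compl (borel_open cF).
Qed.

Hypothesis rhoM : is_metric rho.

Lemma rho_ge0 x y : 0 <= rho x y. Proof. by case: rhoM. Qed.
Lemma rho_refl x : rho x x = 0. Proof. by case: rhoM => _ [h _]; apply/h. Qed.
Lemma rho_sym x y : rho x y = rho y x. Proof. by case: rhoM => _ [_ []]. Qed.
Lemma rho_tri x y z : rho x z <= rho x y + rho y z.
Proof. by case: rhoM => _ [_ []]. Qed.
Lemma rho_eq0 x y : rho x y = 0 -> x = y.
Proof. by case: rhoM => _ [h _] /h. Qed.
Lemma rho_gt0 x y : x <> y -> 0 < rho x y.
Proof.
move=> xy; case: (Rle_lt_or_eq_dec _ _ (rho_ge0 x y)) => // /esym /rho_eq0 e; case: (xy e).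
Qed.

Lemma open_ball x r : open_set rho (ball rho x r).
Proof.
move=> y; rewrite /ball => xy; exists (r - rho x y); split; first lra.
move=> z yz; have := rho_tri x y z; lra.
Qed.

Lemma borel_ball x r : borel rho (ball rho x r).
Proof. apply: borel_open; exact: open_ball. Qed.

Lemma closed_set1 x : closed_set rho (fun y => y = x).
Proof.
move=> y yx; exists (rho y x); split; first exact: rho_gt0.
by move=> z + zx; rewrite /ball zx => /Rlt_irrefl.
Qed.

End Borel.

Fixpoint rsum (f : nat -> R) (n : nat) : R :=
  if n is k.+1 then rsum f k + f k else 0.

Lemma rsum_le f g n : (forall k, f k <= g k) -> rsum f n <= rsum g n.
Proof. by move=> fg; elim: n => [|n IH] /=; [lra|have := fg n; lra]. Qed.

Lemma rsum_half (a : R) n : 0 < a -> rsum (fun k => a * (/ 2) ^ k) n <= 2 * a.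
Proof.
move=> a0; have -> : rsum (fun k => a * (/ 2) ^ k) n = 2 * a - 2 * a * (/ 2) ^ n.
  by elim: n => [|n IH] /=; [lra|rewrite IH; lra].
have := pow_half_gt0 n; nra.
Qed.

(** A finite outer measure with Borel sets Carathéodory measurable. Values are real and countable
    subadditivity is phrased through bounds on partial sums, so that neither infinite values nor
    series occur in the covering arguments. *)
Record finite_borel_measure (X : Type) (rho : X -> X -> R) (m : (X -> Prop) -> R)
  : Prop := FiniteBorelMeasure {
  fbm0 : m (fun _ => False) = 0;
  fbm_mono : forall A B : X -> Prop, (forall x, A x -> B x) -> m A <= m B;
  fbm_csub : forall (A : nat -> X -> Prop) c,
    (forall n, rsum (fun k => m (A k)) n <= c) -> m (fun x => exists n, A n x) <= c;
  fbm_split : forall E, borel rho E -> forall T,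
    m T = m (fun x => T x /\ E x) + m (fun x => T x /\ ~ E x) }.

(** * Continuity and regularity of finite Borel measures *)

Section FiniteMeasure.
Variables (X : Type) (rho : X -> X -> R) (m : (X -> Prop) -> R).
Hypothesis mM : finite_borel_measure rho m.

Lemma fbm_ge0 A : 0 <= m A.
Proof. by rewrite -(fbm0 mM); apply: (fbm_mono mM). Qed.

Lemma fbm_sub2 A B C : (forall x, C x -> A x \/ B x) -> m C <= m A + m B.
Proof.
move=> CAB; pose S (n : nat) : X -> Prop :=
  match n with 0%nat => A | 1%nat => B | _ => fun _ => False end.
apply: (Rle_trans _ (m (fun x => exists n, S n x))).
  by apply: (fbm_mono mM) => x /CAB [] h; [exists 0%nat|exists 1%nat].
apply: (fbm_csub mM) => -[|[|n]] /=.
- have := fbm_ge0 A; have := fbm_ge0 B; lra.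
- have := fbm_ge0 B; lra.
by elim: n => [|n IH] /=; [lra|rewrite (fbm0 mM); lra].
Qed.

(** The union is cut into the successive differences [D n]; splitting along Borel sets makes their
    partial sums telescope to [m (A n)], and countable subadditivity finishes. *)
Lemma fbm_cont_below (A : nat -> X -> Prop) c :
  (forall n, borel rho (A n)) -> (forall n x, A n x -> A n.+1 x) ->
  (forall n, m (A n) <= c) -> m (fun x => exists n, A n x) <= c.
Proof.
move=> bA incA Ac.
pose D n : X -> Prop := if n is k.+1 then fun x => A k.+1 x /\ ~ A k x else A 0%nat.
have sumD n : rsum (fun k => m (D k)) n.+1 = m (A n).
  elim: n => [|n IH]; first by rewrite /=; lra.
  rewrite -/(rsum _ n.+1 + m (D n.+1)) in IH *; rewrite [LHS]/= -/(rsum _ n.+1).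
  rewrite [RHS](fbm_split mM (bA n)).
  have -> : (fun x => A n.+1 x /\ A n x) = A n.
    by apply: set_ext => x; split; [case|move=> h; split=> //; apply: incA].
  by rewrite -IH.
have ->: (fun x => exists n, A n x) = (fun x => exists n, D n x).
  apply: set_ext => x; split; last first.
    by case=> -[|n] /=; [exists 0%nat|case; exists n.+1].
  case=> n; elim: n => [|n IH] Anx; first by exists 0%nat.
  by case: (classic (A n x)) => // nA; exists n.+1.
apply: (fbm_csub mM) => -[|n]; last by rewrite sumD.
rewrite /=; have := Ac 0%nat; have := fbm_ge0 (A 0%nat); lra.
Qed.

(** If every [m (A n)] were at least [eta], the increasing sets [A 0 \ A n] would have mass at most
    [m (A 0) - eta], although they exhaust [A 0]. *)
Lemma fbm_cont_above (A : nat -> X -> Prop) eta :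
  (forall n, borel rho (A n)) -> (forall n x, A n.+1 x -> A n x) ->
  (forall x, exists n, ~ A n x) -> 0 < eta -> exists n, m (A n) < eta.
Proof.
move=> bA decA emp eta0; apply: NNPP => h.
have ge n : eta <= m (A n).
  by case: (Rle_lt_dec eta (m (A n))) => // l; case: h; exists n.
have dec0 n x : A n x -> A 0%nat x by elim: n => // n IH /decA.
have : m (fun x => exists n, A 0%nat x /\ ~ A n x) <= m (A 0%nat) - eta.
  apply: fbm_cont_below => [n|n x [? nA]|n].
  - by apply: borel_and => //; apply: borel_compl.
  - by split=> // /decA.
  have := fbm_split mM (bA n) (A 0%nat); have := ge n.
  have -> : (fun x => A 0%nat x /\ A n x) = A n.
    by apply: set_ext => x; split; [case|move=> k; split=> //; apply: dec0 k].
  lra.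
have : m (A 0%nat) <= m (fun x => exists n, A 0%nat x /\ ~ A n x).
  by apply: (fbm_mono mM) => x A0; have [n nA] := emp x; exists n.
lra.
Qed.

Hypothesis rhoM : is_metric rho.

(** An open set is the increasing union of the closed sets [F n] of points at distance at least
    [/ INR n.+1] from its complement; continuity from above applies to the remainders. *)
Lemma fbm_open_regular (U : X -> Prop) eta : open_set rho U -> 0 < eta ->
  exists F, closed_set rho F /\ (forall x, F x -> U x) /\ m (fun x => U x /\ ~ F x) < eta.
Proof.
move=> oU eta0.
pose F n x := forall y, ~ U y -> / INR n.+1 <= rho x y.
have cF n : closed_set rho (F n).
  move=> x nF; have [y [nU xy]] : exists y, ~ U y /\ rho x y < / INR n.+1.
    apply: NNPP => h; apply: nF => y nU; case: (Rle_lt_dec (/ INR n.+1) (rho x y)) => // l.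
    by case: h; exists y.
  exists (/ INR n.+1 - rho x y); split; first lra.
  move=> z; rewrite /ball => xz /(_ y nU).
  have := rho_tri rhoM z x y; rewrite (rho_sym rhoM z x); lra.
have [|||n ltn] := @fbm_cont_above (fun n x => U x /\ ~ F n x) eta _ _ _ eta0.
- by move=> n; apply: borel_and; [exact: borel_open|by apply: borel_compl; apply: borel_closed].
- move=> n x [Ux nF]; split=> // h; apply: nF => y /h; have := @inv_INR_le n n.+1 (leqnSn n); lra.
- move=> x; case: (classic (U x)) => Ux; last by exists 0%nat; tauto.
  have [r [r0 rU]] := oU x Ux; have [n nr] := exists_inv_lt r0.
  exists n => -[_]; apply=> y nU; case: (Rle_lt_dec r (rho x y)) => [|/rU //]; lra.
exists (F n); split=> //; split=> // x Fx; apply: NNPP => /Fx.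
rewrite (rho_refl rhoM); have := inv_INR_gt0 n; lra.
Qed.

(** The sets with this approximation property for every [eta] form a sigma-algebra containing the
    open sets. Since [borel] quantifies over all such sigma-algebras, it can be applied to this one
    directly. *)
Theorem fbm_regular (A : X -> Prop) eta : borel rho A -> 0 < eta ->
  exists F O, closed_set rho F /\ open_set rho O /\ (forall x, F x -> A x) /\
    (forall x, A x -> O x) /\ m (fun x => O x /\ ~ F x) < eta.
Proof.
move=> bA; move: eta; pattern A; apply: bA; last first.
  move=> U oU eta eta0; have [F [cF [FU lt]]] := fbm_open_regular oU eta0.
  by exists F, U.
split; last split.
- move=> eta eta0; exists (fun _ => True), (fun _ => True); split; first by move=> x [].
  split; first exact: open_True.
  split=> //; split=> //; have -> : (fun _ : X => True /\ ~ True) = (fun _ => False).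
    by apply: set_ext => x; tauto.
  by rewrite (fbm0 mM).
- move=> {}A RA eta eta0; have [F [O [cF [oO [FA [AO lt]]]]]] := RA eta eta0.
  exists (fun x => ~ O x), (fun x => ~ F x); split.
    move=> x /NNPP /oO [r [r0 rO]]; exists r; split=> // y /rO; tauto.
  split=> //; split; first by move=> x nO /AO.
  split; first by move=> x nA /FA.
  have <- : (fun x => O x /\ ~ F x) = (fun x => ~ F x /\ ~ ~ O x); last by [].
  by apply: set_ext => x; split=> [|[? /NNPP]]; tauto.
move=> {}A RA eta eta0.
(* The errors of the pieces add up to at most [eta / 2]. A countable union of closed sets need not
   be closed, so it is truncated to a finite one, at a further cost below [eta / 4]. *)
have e4 n : 0 < eta / 4 * (/ 2) ^ n by have := pow_half_gt0 n; nra.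
pose P n (FO : (X -> Prop) * (X -> Prop)) := closed_set rho FO.1 /\ open_set rho FO.2 /\
  (forall x, FO.1 x -> A n x) /\ (forall x, A n x -> FO.2 x) /\
  m (fun x => FO.2 x /\ ~ FO.1 x) < eta / 4 * (/ 2) ^ n.
have exP n : exists FO, P n FO.
  by have [F [O h]] := RA n _ (e4 n); exists (F, O).
pose FO n := proj1_sig (constructive_indefinite_description _ (exP n)).
have FOP n : P n (FO n) := proj2_sig (constructive_indefinite_description _ (exP n)).
pose FN N x := exists n, (n < N)%nat /\ (FO n).1 x.
have cFN N : closed_set rho (FN N).
  by apply: closed_finite_cup => n; case: (FOP n).
have [||||N ltN] := @fbm_cont_above (fun N x => (exists n, (FO n).1 x) /\ ~ FN N x) (eta / 4).
- move=> n; apply: borel_and; last by apply: borel_compl; apply: borel_closed.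
  by apply: borel_cup => k; apply: borel_closed; case: (FOP k).
- move=> n x [? h]; split=> // -[k [kn Fk]]; apply: h; exists k; split=> //.
  exact: leq_trans kn _.
- move=> x; case: (classic (exists n, (FO n).1 x)) => [[n Fn]|h]; last by exists 0%nat; tauto.
  by exists n.+1 => -[_]; apply; exists n.
- lra.
exists (FN N), (fun x => exists n, (FO n).2 x); split=> //; split.
  move=> x [n On]; case: (FOP n) => _ [/(_ x On) [r [r0 rO]] _].
  by exists r; split=> // y /rO ?; exists n.
split; first by move=> x [n [_ Fn]]; exists n; case: (FOP n) => _ [_ [h _]]; apply: h.
split; first by move=> x [n An]; exists n; case: (FOP n) => _ [_ [_ [h _]]]; apply: h.
have le2 : m (fun x => exists n, (FO n).2 x /\ ~ (FO n).1 x) <= 2 * (eta / 4).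
  have e4_0 : 0 < eta / 4 by lra.
  apply: (fbm_csub mM) => n; apply: Rle_trans (rsum_half n e4_0).
  by apply: rsum_le => k; case: (FOP k) => _ [_ [_ [_]]] /Rlt_le.
apply: (Rle_lt_trans _ (m (fun x => exists n, (FO n).2 x /\ ~ (FO n).1 x) +
  m (fun x => (exists n, (FO n).1 x) /\ ~ FN N x))); last lra.
apply: fbm_sub2 => x [[n On] nF].
case: (classic (exists n, (FO n).1 x)) => h; first by right.
by left; exists n; split=> // Fn; apply: h; exists n.
Qed.

End FiniteMeasure.

(** * Covering by balls *)

Section Covering.
Variables (X : Type) (rho : X -> X -> R) (m : (X -> Prop) -> R).
Hypothesis rhoM : is_metric rho.
Hypothesis mM : finite_borel_measure rho m.

Definition ball_cup (l : list (X * R)) (x : X) : Prop :=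
  exists b, In b l /\ ball rho b.1 b.2 x.

Lemma exists_max_radius (l : list (X * R)) : l <> nil ->
  exists b, In b l /\ forall c, In c l -> c.2 <= b.2.
Proof.
elim: l => // a [|a' l] IH _.
  by exists a; split; [left|move=> c [->|[]]; lra].
have [//|b [bl bmax]] := IH.
case: (Rle_lt_dec a.2 b.2) => ab.
  by exists b; split; [right|move=> c [<- //|/bmax]].
exists a; split; first by left.
by move=> c [->|/bmax]; lra.
Qed.

Lemma length_filter_lt (T : Type) (p : T -> bool) (l : list T) b :
  In b l -> p b = false -> (length (List.filter p l) < length l)%nat.
Proof.
elim: l => // a l IH /= [->|/IH h] pb.
  rewrite pb ltnS; elim: l {IH} => //= c l IH; case: (p c) => //=.
  by rewrite ltnW.
by case: (p a); rewrite /= ltnS ?h // ltnW // h.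
Qed.

(* Vitali's greedy selection on a finite family: keep the largest ball, drop
   the balls meeting it, which all lie in its threefold enlargement. *)
Lemma finite_vitali (B : X -> Prop) (k eps : R) (l : list (X * R)) :
  0 < eps -> 0 <= k ->
  (forall b, In b l -> 0 < b.2 /\
     m (ball rho b.1 (3 * b.2)) <= k * m (ball rho b.1 b.2) /\
     eps * m (ball rho b.1 b.2) <= m (fun x => ball rho b.1 b.2 x /\ ~ B x)) ->
  m (ball_cup l) <= k / eps * m (fun x => ball_cup l x /\ ~ B x).
Proof.
move=> eps0 k0; have ke0 : 0 <= k / eps by apply: Rle_mult_inv_pos.
(* Induction runs on a bound for the length, because one greedy choice may discard many balls. *)
have [n] := ex_intro (fun n => (length l <= n)%nat) _ (leqnn _).
elim: n l => [|n IH] l.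
  case: l => // _ _; have -> : ball_cup nil = (fun _ => False).
    by apply: set_ext => x; split=> // -[b []].
  rewrite (fbm0 mM); apply: Rmult_le_pos => //; exact: (fbm_ge0 mM).
move=> ln hl.
case: (classic (l = nil)) => [l0|l0]; first by apply: IH => //; rewrite l0.
have [b [bl bmax]] := exists_max_radius l0.
pose disj (c : X * R) := forall y, ball rho c.1 c.2 y -> ~ ball rho b.1 b.2 y.
pose p c := if excluded_middle_informative (disj c) then true else false.
have pP c : p c = true <-> disj c by rewrite /p; case: excluded_middle_informative.
have [b0 [bk be]] := hl b bl.
have pb : p b = false.
  apply/negP => /pP /(_ b.1); rewrite /ball (rho_refl rhoM) => /(_ b0); exact.
pose l' := List.filter p l.
have l'P c : In c l' <-> In c l /\ disj c by rewrite /l' filter_In pP.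
have IHl' : m (ball_cup l') <= k / eps * m (fun x => ball_cup l' x /\ ~ B x).
  apply: IH => [|c /l'P [cl _]]; last exact: hl.
  by rewrite -ltnS; apply: leq_trans (length_filter_lt bl pb) ln.
have cov : m (ball_cup l) <= m (ball rho b.1 (3 * b.2)) + m (ball_cup l').
  apply: (fbm_sub2 mM) => x [c [cl cx]].
  case: (classic (disj c)) => [dc|]; first by right; exists c; split=> //; apply/l'P.
  move=> /not_all_ex_not [y ny]; left.
  have {ny} [cy by_] : ball rho c.1 c.2 y /\ ball rho b.1 b.2 y by tauto.
  have := bmax c cl; move: cy by_ cx; rewrite /ball => cy by_ cx.
  have := rho_tri rhoM b.1 y x; have := rho_tri rhoM y c.1 x.
  rewrite (rho_sym rhoM y c.1); lra.
have add : m (fun x => ball rho b.1 b.2 x /\ ~ B x) + m (fun x => ball_cup l' x /\ ~ B x)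
    <= m (fun x => ball_cup l x /\ ~ B x).
  rewrite (fbm_split mM (borel_ball rhoM b.1 b.2) (fun x => ball_cup l x /\ ~ B x)).
  apply: Rplus_le_compat; apply: (fbm_mono mM) => x [].
    by move=> bx nB; split=> //; split=> //; exists b.
  by move=> [c [/l'P [cl dc] cx]] nB; split; [split=> //; exists c|apply: dc].
have step : m (ball rho b.1 (3 * b.2)) <= k / eps * m (fun x => ball rho b.1 b.2 x /\ ~ B x).
  apply: Rle_trans bk _; apply: (Rle_trans _ (k / eps * (eps * m (ball rho b.1 b.2)))).
    by right; field; lra.
  exact: Rmult_le_compat_l.
have := Rmult_le_compat_l _ _ _ ke0 add; lra.
Qed.

Variable q : nat -> X.
Hypothesis q_dense : forall x e, 0 < e -> exists k, rho x (q k) < e.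

(** For each pair [(k, l)] one ball of [G] is chosen whose center is within [/ INR l.+1] of [q k]
    and whose radius exceeds twice that number. If the center [x] of another ball satisfies the same
    condition, the chosen ball contains [x]. The ball [b0] serves as default for pairs without such
    a ball and for codes of no pair. *)
Lemma lindelof_balls (G : X -> R -> Prop) (b0 : X * R) : G b0.1 b0.2 ->
  (forall x r, G x r -> 0 < r) ->
  exists u : nat -> X * R, (forall n, G (u n).1 (u n).2) /\
    forall x r, G x r -> exists n, ball rho (u n).1 (u n).2 x.
Proof.
move=> Gb0 Gpos.
pose P (kl : nat * nat) (b : X * R) :=
  G b.1 b.2 /\ rho b.1 (q kl.1) < / INR kl.2.+1 /\ 2 * / INR kl.2.+1 < b.2.
pose v kl := if excluded_middle_informative (exists b, P kl b)
  then epsilon (inhabits b0) (P kl) else b0.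
have vG kl : G (v kl).1 (v kl).2.
  rewrite /v; case: excluded_middle_informative => // h.
  by case: (epsilon_spec (inhabits b0) (P kl) h).
exists (fun n => if @unpickle (nat * nat)%type n is Some kl then v kl else b0); split.
  by move=> n; case: unpickle.
move=> x r Gxr; have r0 := Gpos _ _ Gxr.
have r2 : 0 < r / 2 by lra.
have [l lr] := exists_inv_lt r2.
have [k xk] := q_dense x (inv_INR_gt0 l).
exists (pickle (k, l)); rewrite pickleK /v.
have ex : exists b, P (k, l) b by exists (x, r); split=> //; split=> //; change (2 * / INR l.+1 < r); lra.
case: excluded_middle_informative => [?|//].
have [_ [yk ry]] := epsilon_spec (inhabits b0) (P (k, l)) ex.
move: (epsilon _ _) yk ry => b; rewrite /ball [(k, l).1]/= [(k, l).2]/= => yk ry.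
have := rho_tri rhoM b.1 (q k) x; rewrite (rho_sym rhoM (q k) x) /=; lra.
Qed.

(** By regularity [B] lies between a closed [F] and an open [O] with [m (O \ F) < eta]. Balls inside
    [O] in which the complement of [B] has proportion at least [eps] cover [N]; Vitali bounds every
    finite union of them by [k / eps] times its mass outside [B], hence by [k / eps * eta].
    Countable subcovers and continuity from below pass to all of [N]. *)
Lemma density_null (B N : X -> Prop) (k eps : R) :
  borel rho B -> (forall x, N x -> B x) -> 0 < eps -> 0 <= k ->
  (forall x, N x -> forall delta, 0 < delta -> exists r, 0 < r /\ r < delta /\
     m (ball rho x (3 * r)) <= k * m (ball rho x r) /\
     eps * m (ball rho x r) <= m (fun y => ball rho x r y /\ ~ B y)) ->
  m N = 0.
Proof.
move=> bB NB eps0 k0 hN.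
have ke0 : 0 <= k / eps by apply: Rle_mult_inv_pos.
apply: Rle_antisym; last exact: (fbm_ge0 mM).
suff le eta : 0 < eta -> m N <= k / eps * eta.
  apply: Rnot_lt_le => mN.
  (* With this [eta] the bound would give [m N <= m N / 2]; the [+ 1] keeps the denominator
     positive. *)
  have h : 0 < m N / 2 / (k / eps + 1).
    by apply: Rdiv_lt_0_compat; lra.
  have := le _ h.
  have : k / eps * (m N / 2 / (k / eps + 1)) <= m N / 2; last lra.
  have {2}-> : m N / 2 = (k / eps + 1) * (m N / 2 / (k / eps + 1)) by field; lra.
  apply: Rmult_le_compat_r; lra.
move=> eta0.
have [F [O [cF [oO [FB [BO lt]]]]]] := fbm_regular mM rhoM bB eta0.
pose G x r := N x /\ 0 < r /\ (forall y, ball rho x r y -> O y) /\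
  m (ball rho x (3 * r)) <= k * m (ball rho x r) /\
  eps * m (ball rho x r) <= m (fun y => ball rho x r y /\ ~ B y).
have NG x : N x -> exists r, G x r.
  move=> Nx; have [d [d0 dO]] := oO x (BO _ (NB _ Nx)).
  have [r [r0 [rd [? ?]]]] := hN x Nx d d0; exists r; split=> //; split=> //; split=> //.
  by move=> y; rewrite /ball => xy; apply: dO; rewrite /ball; lra.
case: (classic (exists x, N x)) => [[x0 Nx0]|N0]; last first.
  have -> : N = (fun _ => False) by apply: set_ext => x; split=> // Nx; apply: N0; exists x.
  by rewrite (fbm0 mM); apply: Rmult_le_pos => //; lra.
have [r0 G0] := NG _ Nx0.
have [//|x r [_ []] //|u [uG ucov]] := @lindelof_balls G (x0, r0).
apply: (Rle_trans _ (m (fun x => exists n, ball_cup (List.map u (List.seq 0 n)) x))).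
  apply: (fbm_mono mM) => x /NG [r /ucov [n nx]]; exists n.+1, (u n); split=> //.
  by apply: in_map; apply/in_seq; split; [apply: PeanoNat.Nat.le_0_l|apply/ltP].
apply: (fbm_cont_below mM).
- move=> n; apply: borel_open => x [b [bl bx]].
  have [r [r_gt0 rb]] := open_ball rhoM bx; exists r; split=> // y /rb yb.
  by exists b.
- move=> n x [b [/in_map_iff [i [ib /in_seq [_ ilt]]] bx]].
  exists b; split=> //; apply/in_map_iff; exists i; split=> //; apply/in_seq; split.
    exact: PeanoNat.Nat.le_0_l.
  exact: (PeanoNat.Nat.lt_trans _ _ _ ilt (PeanoNat.Nat.lt_succ_diag_r _)).
move=> n; apply: (Rle_trans _ (k / eps * m (fun x => ball_cup (List.map u (List.seq 0 n)) x /\ ~ B x))).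
  apply: finite_vitali => // b /in_map_iff [i [<- _]].
  by case: (uG i) => _ [? [_ ?]].
apply: Rmult_le_compat_l => //; apply: Rle_trans (Rlt_le _ _ lt).
apply: (fbm_mono mM) => x [[b [/in_map_iff [i [<- _]] bx]] nB].
by split; [case: (uG i) => _ [_ [h _]]; apply: h|move=> /FB].
Qed.

End Covering.

(** * Density points in a doubling space *)

Section OuterMeasure.
Variables (X : Type) (mu : (X -> Prop) -> Rbar).
Hypothesis muO : outer_measure mu.

Lemma mu_mono (A B : X -> Prop) : (forall x, A x -> B x) -> Rbar_le (mu A) (mu B).
Proof. by case: muO => _ [_ [h _]]; apply: h. Qed.

Lemma null_mono (A B : X -> Prop) :
  (forall x, A x -> B x) -> mu B = Finite 0 -> mu A = Finite 0.
Proof.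
move=> AB B0; apply: Rbar_le_antisym; first by rewrite -B0; apply: mu_mono.
by case: muO => _ [h _].
Qed.

Lemma null_cup (A : nat -> X -> Prop) :
  (forall n, mu (A n) = Finite 0) -> mu (fun x => exists n, A n x) = Finite 0.
Proof.
move=> A0; apply: Rbar_le_antisym; last by case: muO => _ [h _].
case: muO => _ [_ [_ h]]; apply: h => n.
have -> : psum (fun k => mu (A k)) n = Finite 0.
  by elim: n => //= n ->; rewrite A0 /=; congr Finite; lra.
exact: Rbar_le_refl.
Qed.

Lemma null_or (A B : X -> Prop) :
  mu A = Finite 0 -> mu B = Finite 0 -> mu (fun x => A x \/ B x) = Finite 0.
Proof.
move=> A0 B0.
apply: (null_mono (B := fun x => exists n : nat, (if n is O then A else B) x)).
  by move=> x []; [exists 0%nat|exists 1%nat].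
by apply: null_cup => -[|n].
Qed.

Lemma Rbar_plus_nneg_assoc (a b c : Rbar) :
  Rbar_le (Finite 0) a -> Rbar_le (Finite 0) b -> Rbar_le (Finite 0) c ->
  Rbar_plus (Rbar_plus a b) c = Rbar_plus a (Rbar_plus b c).
Proof.
by case: a => [a||]; case: b => [b||]; case: c => [c||] //= _ _ _; congr Finite; lra.
Qed.

Lemma null_measurable (Z : X -> Prop) : mu Z = Finite 0 -> mu_measurable mu Z.
Proof.
move=> Z0 T; have -> : mu (fun x => T x /\ Z x) = Finite 0.
  by apply: null_mono Z0 => x [].
rewrite Rbar_plus_0_l; apply: Rbar_le_antisym; last by apply: mu_mono => x [].
case: (muO) => e0 [ge0 [_ h]].
pose S (n : nat) x := match n with O => T x /\ ~ Z x | _ => Z x end.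
apply: (Rbar_le_trans _ (mu (fun x => exists n, S n x))).
  apply: mu_mono => x Tx; case: (classic (Z x)); first by exists 1%nat.
  by exists 0%nat.
apply: h => -[|n]; first exact: ge0.
have -> : psum (fun k => mu (S k)) n.+1 = mu (S 0%nat); last exact: Rbar_le_refl.
elim: n => [|n IH]; first by rewrite /= Rbar_plus_0_l.
by rewrite -[LHS]/(Rbar_plus (psum (fun k => mu (S k)) n.+1) (mu Z)) IH Z0 Rbar_plus_0_r.
Qed.

Lemma measurable_compl (A : X -> Prop) :
  mu_measurable mu A -> mu_measurable mu (fun x => ~ A x).
Proof.
move=> mA T; rewrite (mA T) Rbar_plus_comm; congr (Rbar_plus _ (mu _)).
by apply: set_ext => x; split=> [|[? /NNPP]]; tauto.
Qed.

Lemma measurable_and (A B : X -> Prop) :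
  mu_measurable mu A -> mu_measurable mu B -> mu_measurable mu (fun x => A x /\ B x).
Proof.
move=> mA mB T; have ge0 S : Rbar_le (Finite 0) (mu S) by case: muO => _ [].
rewrite (mA T) (mB (fun x => T x /\ A x)).
rewrite (mA (fun x => T x /\ ~ (A x /\ B x))) Rbar_plus_nneg_assoc //.
congr (Rbar_plus (mu _) (Rbar_plus (mu _) (mu _))); apply: set_ext => x; tauto.
Qed.

End OuterMeasure.

(** * Volumes of balls and Lebesgue density *)

Section Doubling.
Variables (X : Type) (rho : X -> X -> R) (mu : (X -> Prop) -> Rbar) (K : R).
Hypothesis XD : doubling_mms rho mu K.

Let rhoM : is_metric rho. Proof. by case: XD => _ []. Qed.
Let muO : outer_measure mu. Proof. by case: XD => _ [_ [_ [_ []]]]. Qed.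
Let muB : borel_regular rho mu. Proof. by case: XD => _ [_ [_ [_ [_ []]]]]. Qed.
Let muD : forall x r, 0 < r ->
     Rbar_lt (Finite 0) (mu (ball rho x (2 * r))) /\
     Rbar_le (mu (ball rho x (2 * r))) (Rbar_mult (Finite K) (mu (ball rho x r))) /\
     Rbar_lt (mu (ball rho x r)) p_infty.
Proof. by case: XD => _ [_ [_ [_ [_ []]]]]. Qed.

(** [real] sends infinite values to 0, so [vol] is only used where [mu_finite] applies, that is, for
    sets contained in a ball. *)
Definition vol (A : X -> Prop) : R := real (mu A).

Lemma mu_finite (A : X -> Prop) x r : 0 < r -> (forall y, A y -> ball rho x r y) ->
  mu A = Finite (vol A).
Proof.
move=> r0 /(mu_mono muO); have [_ [_]] := muD x r0.
have := proj1 (proj2 muO) A; rewrite /vol.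
by case: (mu A) => // _; case: (mu _).
Qed.

(** Balls have finite measure, so restricting [mu] to a ball makes the finite theory available;
    global statements follow by exhausting the space with balls. *)
Lemma restriction_measure p r : 0 < r ->
  finite_borel_measure rho (fun A => vol (fun x => ball rho p r x /\ A x)).
Proof.
move=> r0.
have fin (A : X -> Prop) : mu (fun x => ball rho p r x /\ A x) =
    Finite (vol (fun x => ball rho p r x /\ A x)).
  by apply: (mu_finite r0 (x := p)) => y [].
split.
- have -> : (fun x => ball rho p r x /\ False) = (fun _ => False).
    by apply: set_ext => x; tauto.
  by case: muO => e0 _; rewrite /vol e0.
- move=> A B AB; have := @mu_mono _ _ muO (fun x => ball rho p r x /\ A x)
    (fun x => ball rho p r x /\ B x); rewrite !fin; apply=> x [? /AB]; tauto.
- move=> A c sumc; case: (muO) => _ [_ [_ h]].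
  have {}h := h (fun n x => ball rho p r x /\ A n x) (Finite c).
  have eqp n : psum (fun k => mu (fun x => ball rho p r x /\ A k x)) n =
      Finite (rsum (fun k => vol (fun x => ball rho p r x /\ A k x)) n).
    by elim: n => //= n ->; rewrite fin.
  have e : (fun x => ball rho p r x /\ (exists n, A n x)) =
           (fun x => exists n, ball rho p r x /\ A n x).
    by apply: set_ext => x; split=> [[? [n ?]]|[n []]]; [exists n|split=> //; exists n].
  have := fin (fun x => exists n, A n x); rewrite {1}e => e2.
  by move: h; rewrite e2; apply=> n; rewrite eqp; apply: sumc.
move=> E bE T; have := proj1 muB E bE (fun x => ball rho p r x /\ T x).
have e (S : X -> Prop) : (fun x => (ball rho p r x /\ T x) /\ S x) =
    (fun x => ball rho p r x /\ T x /\ S x).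
  by apply: set_ext => x; tauto.
by rewrite !e !fin => -[].
Qed.

Lemma vol_ball_gt0 x r : 0 < r -> 0 < vol (ball rho x r).
Proof.
move=> r0; have r2 : 0 < r / 2 by lra.
have := proj1 (muD x r2); have -> : 2 * (r / 2) = r by field.
by rewrite (mu_finite r0 (A := ball rho x r) (x := x)).
Qed.

Lemma vol_ge0 A : 0 <= vol A.
Proof. by have := proj1 (proj2 muO) A; rewrite /vol; case: (mu A) => //= *; lra. Qed.

Lemma vol_mono (A B : X -> Prop) p r : 0 < r -> (forall x, B x -> ball rho p r x) ->
  (forall x, A x -> B x) -> vol A <= vol B.
Proof.
move=> r0 Br AB; have := mu_mono muO AB.
by rewrite (mu_finite r0 Br) (mu_finite r0 (A := A) (x := p)) // => x /AB /Br.
Qed.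

Lemma vol_sub2 (A B C : X -> Prop) p r : 0 < r -> (forall x, A x -> ball rho p r x) ->
  (forall x, B x -> ball rho p r x) -> (forall x, C x -> A x \/ B x) ->
  vol C <= vol A + vol B.
Proof.
move=> r0 Ar Br CAB; have := fbm_sub2 (restriction_measure p r0) CAB.
have e (S : X -> Prop) : (forall x, S x -> ball rho p r x) ->
    (fun x => ball rho p r x /\ S x) = S.
  by move=> Sr; apply: set_ext => x; split=> [[]//|h]; split=> //; apply: Sr.
by rewrite !e // => x /CAB [/Ar|/Br].
Qed.

Lemma vol_ball_mono x r s : 0 < s -> r <= s -> vol (ball rho x r) <= vol (ball rho x s).
Proof. by move=> s0 rs; apply: (vol_mono (p := x) s0) => // y; rewrite /ball; lra. Qed.

Lemma vol_doubling x r : 0 < r -> vol (ball rho x (2 * r)) <= K * vol (ball rho x r).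
Proof.
move=> r0; have r2 : 0 < 2 * r by lra.
have [_ [+ _]] := muD x r0.
by rewrite (mu_finite r0 (A := ball rho x r) (x := x)) // (mu_finite r2 (x := x)).
Qed.

Lemma vol_doubling_iter n x r : 0 < r ->
  vol (ball rho x (2 ^ n * r)) <= K ^ n * vol (ball rho x r).
Proof.
move=> r0; have K0 : 0 < K by case: XD.
elim: n => [|n IH]; first by rewrite /= !Rmult_1_l; lra.
have r1 : 0 < 2 ^ n * r by apply: Rmult_lt_0_compat => //; apply: pow_lt; lra.
rewrite /= Rmult_assoc; apply: Rle_trans (vol_doubling x r1) _.
by rewrite Rmult_assoc; apply: Rmult_le_compat_l => //; lra.
Qed.

(** Density with the quotient cleared to a non-strict product bound, so that volumes can be added
    and compared directly; [mu_nbhdP] identifies it with the limit in [mu_nbhd]. *)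
Definition density_point (B : X -> Prop) (x : X) : Prop :=
  forall eps, 0 < eps -> exists delta, 0 < delta /\ forall r, 0 < r -> r < delta ->
    vol (fun y => ball rho x r y /\ ~ B y) <= eps * vol (ball rho x r).

Lemma mu_nbhdP x (E : X -> Prop) : mu_nbhd rho mu x E <->
  E x /\ exists B, borel rho B /\ (forall y, B y -> E y) /\ density_point B x.
Proof.
split=> -[Ex [B [bB [BE h]]]]; split=> //; exists B; split=> //; split=> // eps eps0.
  have [d [d0 hd]] := h eps eps0; exists d; split=> // r r0 rd.
  have v0 := vol_ball_gt0 x r0; have := hd r r0 rd; rewrite Rabs_pos_eq; last first.
    by apply: Rle_mult_inv_pos => //; apply: vol_ge0.
  move=> /(Rmult_lt_compat_r _ _ _ v0); rewrite /Rdiv Rmult_assoc Rinv_l; last first.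
    by apply: Rgt_not_eq.
  by rewrite Rmult_1_r => /Rlt_le.
have e2 : 0 < eps / 2 by lra.
have [d [d0 hd]] := h _ e2; exists d; split=> // r r0 rd.
have v0 := vol_ball_gt0 x r0; rewrite Rabs_pos_eq; last first.
  by apply: Rle_mult_inv_pos => //; apply: vol_ge0.
apply: (Rmult_lt_reg_r _ _ _ v0); rewrite /Rdiv Rmult_assoc Rinv_l; last first.
  by apply: Rgt_not_eq.
have := hd r r0 rd; rewrite -/(vol _) -/(vol (ball _ _ _)); nra.
Qed.

Lemma density_point_and (A B : X -> Prop) x :
  density_point A x -> density_point B x -> density_point (fun y => A y /\ B y) x.
Proof.
move=> dA dB eps eps0; have e2 : 0 < eps / 2 by lra.
have [a [a0 ha]] := dA _ e2; have [b [b0 hb]] := dB _ e2.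
exists (Rmin a b); split; first exact: Rmin_pos.
move=> r r0 rab; have := ha r r0; have := hb r r0.
have := Rmin_l a b; have := Rmin_r a b => ? ? /(_ _) h1 /(_ _) h2.
have {}h1 := h1 ltac:(lra); have {}h2 := h2 ltac:(lra).
apply: (Rle_trans _ (vol (fun y => ball rho x r y /\ ~ A y) +
  vol (fun y => ball rho x r y /\ ~ B y))); last lra.
by apply: (vol_sub2 (p := x) r0) => y; tauto.
Qed.

Lemma mu_nbhd_and x (A B : X -> Prop) :
  mu_nbhd rho mu x A -> mu_nbhd rho mu x B -> mu_nbhd rho mu x (fun y => A y /\ B y).
Proof.
move=> /mu_nbhdP [Ax [A' [bA [AA' dA]]]] /mu_nbhdP [Bx [B' [bB [BB' dB]]]].
apply/mu_nbhdP; split=> //; exists (fun y => A' y /\ B' y); split; first exact: borel_and.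
by split; [move=> y [/AA' ? /BB']|apply: density_point_and].
Qed.

Lemma mu_nbhd_mono x (A B : X -> Prop) :
  (forall y, A y -> B y) -> mu_nbhd rho mu x A -> mu_nbhd rho mu x B.
Proof.
move=> AB [Ax [A' [bA [AA' dA]]]]; split; first exact: AB.
by exists A'; split=> //; split=> // y /AA' /AB.
Qed.

Lemma metric_nbhd_mu x (A : X -> Prop) : metric_nbhd rho x A -> mu_nbhd rho mu x A.
Proof.
move=> [Ax [r [r0 rA]]]; apply/mu_nbhdP; split=> //.
exists (ball rho x r); split; first exact: borel_ball; split=> // eps eps0.
exists r; split=> // s s0 sr.
have -> : (fun y => ball rho x s y /\ ~ ball rho x r y) = (fun _ => False).
  by apply: set_ext => y; rewrite /ball; split=> //; lra.
rewrite {1}/vol; case: muO => -> _ /=.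
by have := vol_ball_gt0 x s0; nra.
Qed.

(** With [s = rho x y], a ball of radius [eps * s] about [y] that missed [U] would lie in
    [ball rho x (2 * s)] outside the Borel core of [U]. By doubling it carries a fixed fraction of
    the volume of that ball, which contradicts density. *)
Lemma mu_nbhd_dense x (U : X -> Prop) eps : mu_nbhd rho mu x U -> 0 < eps ->
  exists delta, 0 < delta /\ forall y, 0 < rho x y -> rho x y < delta ->
    exists z, U z /\ rho y z < eps * rho x y.
Proof.
move=> /mu_nbhdP [_ [B [bB [BU dB]]]] eps0.
have K0 : 0 < K by case: XD.
(* This keeps the ball of radius [eps * s] about [y] inside [ball rho x (2 * s)]. *)
wlog eps1 : eps eps0 / eps <= 1.
  have m0 : 0 < Rmin eps 1 by apply: Rmin_pos => //; lra.
  move=> /(_ _ m0 (Rmin_r _ _)) [d [d0 hd]].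
  exists d; split=> // y y0 yd; have [z [Uz yz]] := hd y y0 yd; exists z; split=> //.
  have := Rmin_l eps 1; nra.
have [n hn] : exists n, 4 <= 2 ^ n * eps.
  have h2 : Rabs 2 > 1 by rewrite Rabs_pos_eq; lra.
  have [N hN] := Pow_x_infinity 2 h2 (4 / eps); exists N.
  have := hN N (PeanoNat.Nat.le_refl _); rewrite Rabs_pos_eq; last by apply: pow_le; lra.
  move=> /Rge_le h; have := Rmult_le_compat_r eps _ _ (Rlt_le _ _ eps0) h.
  have -> : 4 / eps * eps = 4 by field; lra.
  done.
(* As [4 <= 2 ^ n * eps], [n] doublings of the small ball cover [ball rho x (2 * s)], so its share
   is at least [/ K ^ n]; half of that is the density threshold. *)
have Kn : 0 < / (2 * K ^ n) by apply: Rinv_0_lt_compat; have := pow_lt K n K0; lra.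
have [d [d0 hd]] := dB _ Kn; exists (d / 2); split; first lra.
move=> y y0 yd; apply: NNPP => h.
set s := rho x y in y0 yd h.
have es : 0 < eps * s by nra.
have s2 : 0 < 2 * s by lra.
have v0 := vol_ball_gt0 x s2.
have le1 : vol (ball rho y (eps * s)) <= vol (fun z => ball rho x (2 * s) z /\ ~ B z).
  apply: (vol_mono (p := x) s2) => [z []//|z]; rewrite /ball => yz; split.
    by have := rho_tri rhoM x y z; rewrite -/s; nra.
  by move=> /BU Uz; apply: h; exists z.
have le2 : vol (ball rho x (2 * s)) <= vol (ball rho y (4 * s)).
  have s4 : 0 < 4 * s by lra.
  apply: (vol_mono (p := y) s4) => // z; rewrite /ball => xz.
  by have := rho_tri rhoM y x z; rewrite (rho_sym rhoM y x) -/s; lra.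
have le3 : vol (ball rho y (4 * s)) <= vol (ball rho y (2 ^ n * (eps * s))).
  apply: vol_ball_mono; last nra.
  by apply: Rmult_lt_0_compat => //; apply: pow_lt; lra.
have le4 := vol_doubling_iter n y es.
have le5 : vol (fun z => ball rho x (2 * s) z /\ ~ B z) <= / (2 * K ^ n) * vol (ball rho x (2 * s)).
  apply: hd => //; lra.
have Kn0 := pow_lt K n K0.
have : K ^ n * vol (ball rho y (eps * s)) <= K ^ n * (/ (2 * K ^ n) * vol (ball rho x (2 * s))).
  apply: Rmult_le_compat_l; lra.
have -> : K ^ n * (/ (2 * K ^ n) * vol (ball rho x (2 * s))) = vol (ball rho x (2 * s)) / 2.
  by field; lra.
lra.
Qed.

Lemma exists_dense_seq (x0 : X) :
  exists q : nat -> X, forall x e, 0 < e -> exists k, rho x (q k) < e.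
Proof.
have [D [[g ginj] Dd]] : separable_space rho by case: XD => _ [_ [_ []]].
exists (fun n => epsilon (inhabits x0) (fun y => D y /\ g y = n)) => x e e0.
have [y [Dy xy]] := Dd x e e0; exists (g y).
have [Dz gz] := epsilon_spec (inhabits x0) (fun z => D z /\ g z = g y) (ex_intro _ y (conj Dy erefl)).
by rewrite (ginj _ _ Dz Dy gz).
Qed.

(** Failure of density at [x] means that, for some [j], the complement of [B] fills a proportion
    [/ INR j.+1] of arbitrarily small balls about [x]. Each such set of points is null by
    [density_null]; the constant [K ^ 2] arises because the tripled ball lies in the ball of radius
    [4 * r]. *)
Lemma borel_density p s (B : X -> Prop) : 0 < s -> borel rho B ->
  mu (fun x => (ball rho p s x /\ B x) /\ ~ density_point B x) = Finite 0.
Proof.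
move=> s0 bB; have K0 : 0 < K by case: XD.
have [q qd] := exists_dense_seq p.
pose N j x := (ball rho p s x /\ B x) /\ forall delta, 0 < delta -> exists r, 0 < r /\ r < delta /\
  / INR j.+1 * vol (ball rho x r) <= vol (fun y => ball rho x r y /\ ~ B y).
apply: (null_mono muO (B := fun x => exists j, N j x)).
  move=> x [Bx nd]; have [eps h'] := not_all_ex_not _ _ nd.
  have [eps0 h] := imply_to_and _ _ h'.
  have [j je] := exists_inv_lt eps0; exists j; split=> // delta delta0.
  apply: NNPP => h2; apply: h; exists delta; split=> // r r0 rd.
  apply: Rnot_lt_le => lt; apply: h2; exists r; split=> //; split=> //.
  have := vol_ball_gt0 x r0; nra.
apply: (null_cup muO) => j.
have sub x : N j x -> ball rho p s x by case=> -[].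
rewrite (mu_finite s0 sub); congr Finite.
have e (S : X -> Prop) : (forall x, S x -> ball rho p s x) ->
    (fun x => ball rho p s x /\ S x) = S.
  by move=> Sr; apply: set_ext => x; split=> [[]//|h]; split=> //; apply: Sr.
rewrite -(e _ sub).
apply: (density_null rhoM (restriction_measure p s0) qd bB (k := K ^ 2) _ (inv_INR_gt0 j)).
- by move=> x [[]].
- by apply: pow_le; lra.
move=> x [[px Bx] hx] delta delta0.
(* Radii below [s - rho p x] keep the balls inside [ball rho p s], where the restricted measure
   equals [vol]. *)
have d0 : 0 < Rmin delta (s - rho p x) by apply: Rmin_pos => //; move: px; rewrite /ball; lra.
have [r [r0 [rd hr]]] := hx _ d0; exists r; split=> //.
have := Rmin_l delta (s - rho p x); have := Rmin_r delta (s - rho p x) => ? ?.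
split; first lra.
have inb y : ball rho x r y -> ball rho p s y.
  by rewrite /ball => xy; have := rho_tri rhoM p x y; lra.
rewrite (e _ inb) (e (fun y => ball rho x r y /\ ~ B y)); last by move=> y [/inb].
split=> //; apply: Rle_trans (vol_doubling_iter 2 x r0).
have r4 : 0 < 2 ^ 2 * r by lra.
by apply: (vol_mono (p := x) r4) => // y [_]; rewrite /ball; lra.
Qed.

(** Inside each ball, the part of the complement of [A] has a Borel hull [H] of the same finite
    measure. Removing [H] leaves a Borel subset of [A], and measurability of [A] shows that only a
    null part of [A] is lost, so the Borel case applies. *)
Theorem lebesgue_density (A : X -> Prop) : mu_measurable mu A ->
  mu (fun x => A x /\ ~ mu_nbhd rho mu x A) = Finite 0.
Proof.
move=> mA; case: (classic (exists p : X, True)) => [[p _]|noX]; last first.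
  have -> : (fun x => A x /\ ~ mu_nbhd rho mu x A) = (fun _ => False).
    by apply: set_ext => x; case: noX; exists x.
  by case: muO.
apply: (null_mono muO (B := fun x => exists n, ball rho p (INR n.+1) x /\ A x /\ ~ mu_nbhd rho mu x A)).
  move=> x h; have [n xn] := exists_INR_ge (rho p x + 1); exists n; split=> //.
  by rewrite /ball; lra.
apply: (null_cup muO) => n; set s := INR n.+1.
have s0 : 0 < s by apply: lt_0_INR; apply: PeanoNat.Nat.lt_0_succ.
have [H [bH [AH muH]]] := proj2 muB (fun x => ball rho p s x /\ ~ A x).
pose B x := ball rho p s x /\ ~ H x.
have bB : borel rho B by apply: borel_and; [apply: borel_ball|apply: borel_compl].
have BA x : B x -> A x by case=> px nH; apply: NNPP => nA; apply: nH; apply: AH.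
have nullHA : mu (fun x => H x /\ A x) = Finite 0.
  have fin : mu (fun x => ball rho p s x /\ ~ A x) = Finite (vol (fun x => ball rho p s x /\ ~ A x)).
    by apply: (mu_finite s0 (x := p)) => y [].
  have := mA H; rewrite muH fin.
  have : Rbar_le (mu (fun x => ball rho p s x /\ ~ A x)) (mu (fun x => H x /\ ~ A x)).
    by apply: (mu_mono muO) => x h; split; [exact: AH|case: h].
  rewrite fin; have := proj1 (proj2 muO) (fun x => H x /\ A x).
  case: (mu (fun x => H x /\ A x)) => [a||] //; case: (mu (fun x => H x /\ ~ A x)) => [b||] //=.
  by move=> ? ? [?]; congr Finite; lra.
apply: (null_mono muO (B := fun x => (H x /\ A x) \/ ((ball rho p s x /\ B x) /\ ~ density_point B x))).
  move=> x [px [Ax nA]]; case: (classic (H x)) => Hx; first by left.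
  right; split=> // dB; apply: nA; apply/mu_nbhdP; split=> //.
  by exists B.
by apply: (null_or muO) => //; apply: borel_density.
Qed.

End Doubling.

(** * Q-points and Lipschitz selections *)

Lemma functional_choice (T U : Type) (P : T -> U -> Prop) :
  (forall t, exists u, P t u) -> exists f, forall t, P t (f t).
Proof.
move=> h; exists (fun t => proj1_sig (constructive_indefinite_description _ (h t))) => t.
exact: proj2_sig (constructive_indefinite_description _ (h t)).
Qed.

Lemma finite_uniform (T : finType) (P : T -> nat -> Prop) :
  (forall t n m, (n <= m)%nat -> P t n -> P t m) -> (forall t, exists n, P t n) ->
  exists n, forall t, P t n.
Proof.
move=> mono ex; suff [n hn] : exists n, forall t, t \in enum T -> P t n.
  by exists n => t; apply: hn; rewrite mem_enum.
elim: (enum T) => [|t s [n IH]]; first by exists 0%nat.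
have [m Pm] := ex t; exists (maxn m n) => u; rewrite inE => /orP[/eqP ->|/IH].
  by apply: mono Pm; apply: leq_maxl.
by apply: mono; apply: leq_maxr.
Qed.

Lemma le0_of_le_all_eps (a : R) : (forall e, 0 < e -> a <= e) -> a <= 0.
Proof. by move=> h; apply: le_epsilon => e e0; rewrite Rplus_0_l; apply: h. Qed.

Section QPoints.
Variables (M : Type) (d : M -> M -> R) (Q : nat).
Hypothesis dM : is_metric d.
Implicit Types A B C : AQ M Q.

(* Matching distance in the maximum norm: up to the factor [Q] it bounds
   [Gdist], and its triangle inequality needs no Minkowski inequality. *)
Definition close A B (c : R) : Prop := exists s : 'S_Q, forall i, d (A i) (B (s i)) <= c.

Lemma close_refl A c : 0 <= c -> close A A c.
Proof. by move=> c0; exists 1%g => i; rewrite perm1 (rho_refl dM). Qed.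

Lemma close_pointwise A B c : (forall i, d (A i) (B i) <= c) -> close A B c.
Proof. by move=> h; exists 1%g => i; rewrite perm1. Qed.

Lemma close_sym A B c : close A B c -> close B A c.
Proof.
move=> [s h]; exists (s^-1)%g => i; rewrite (rho_sym dM).
by have := h ((s^-1)%g i); rewrite permKV.
Qed.

Lemma close_tri A B C a b : close A B a -> close B C b -> close A C (a + b).
Proof.
move=> [s hs] [t ht]; exists (s * t)%g => i; rewrite permM.
have := hs i; have := ht (s i); have := rho_tri dM (A i) (B (s i)) (C (t (s i))); lra.
Qed.

Lemma close_mono A B a b : a <= b -> close A B a -> close A B b.
Proof. by move=> ab [s h]; exists s => i; have := h i; lra. Qed.

Lemma eqAQ_close A B : eqAQ A B -> close A B 0.
Proof. by move=> [s h]; exists s => i; rewrite h (rho_refl dM); lra. Qed.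

Lemma Gdist_ge0 A B : 0 <= Gdist d A B.
Proof. exact: sqrt_pos. Qed.

(** The minimum over permutations is attained, and each summand is bounded by the whole sum of
    squares. *)
Lemma Gdist_close A B : close A B (Gdist d A B).
Proof.
have [s hs] : exists s, foldr (fun s acc => Rmin (Gcost d A B s) acc)
    (Gcost d A B 1%g) (enum 'S_Q) = Gcost d A B s.
  elim: (enum _) => [|s l [t IH]] /=; first by exists 1%g.
  rewrite IH /Rmin; case: Rle_dec => _; first by exists s.
  by exists t.
exists s => i; rewrite /Gdist hs -(sqrt_Rsqr (d (A i) (B (s i)))); last exact: (rho_ge0 dM).
apply: sqrt_le_1_alt; rewrite /Gcost.
have : i \in enum 'I_Q by rewrite mem_enum.
elim: (enum 'I_Q) => //= j l IH; rewrite inE => /orP[/eqP <-|/IH h].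
  have : 0 <= foldr (fun i acc => Rsqr (d (A i) (B (s i))) + acc) 0 l.
    elim: l {IH} => [|k l IH] /=; [lra|have := Rle_0_sqr (d (A k) (B (s k))); lra].
  lra.
have := Rle_0_sqr (d (A j) (B (s j))); lra.
Qed.

Lemma close_Gdist A B c : 0 <= c -> close A B c -> Gdist d A B <= INR Q * c.
Proof.
move=> c0 [s h]; have Q0 := pos_INR Q.
rewrite -(sqrt_Rsqr (INR Q * c)); last exact: Rmult_le_pos.
apply: sqrt_le_1_alt; apply: (Rle_trans _ (Gcost d A B s)).
  have : s \in enum 'S_Q by rewrite mem_enum.
  elim: (enum _) => //= t l IH; rewrite inE => /orP[/eqP <-|/IH]; first exact: Rmin_l.
  exact: Rle_trans (Rmin_r _ _).
apply: (Rle_trans _ (INR Q * Rsqr c)).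
  have -> : INR Q = INR (size (enum 'I_Q)) by rewrite -cardE card_ord.
  rewrite /Gcost; elim: (enum 'I_Q) => [|i l IH]; first by rewrite /=; lra.
  rewrite [size _]/= S_INR /=.
  have : Rsqr (d (A i) (B (s i))) <= Rsqr c by apply: Rsqr_incr_1 => //; apply: (rho_ge0 dM).
  move: (foldr _ _ _) (INR (size l)) (Rsqr c) IH => F N C; lra.
rewrite /Rsqr; case: (Q) => [|n]; first by rewrite /=; lra.
have : 1 <= INR n.+1 by rewrite S_INR; have := pos_INR n; lra.
have : 0 <= c * c by nra.
nra.
Qed.

(** The matching may vary with [c]; one permutation attaining [Gdist], which is here zero, gives
    exact equality. *)
Lemma eqAQ_of_close A B : (forall c, 0 < c -> close A B c) -> eqAQ A B.
Proof.
move=> h; have [s hs] := Gdist_close A B; exists s => i.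
apply: (rho_eq0 dM); apply: Rle_antisym; last exact: (rho_ge0 dM).
apply: Rle_trans (hs i) _; apply: le0_of_le_all_eps => e e0.
have Q0 := pos_INR Q.
have c0 : 0 < e / (INR Q + 1) by apply: Rdiv_lt_0_compat; lra.
apply: Rle_trans (close_Gdist (Rlt_le _ _ c0) (h _ c0)) _.
have {2}-> : e = (INR Q + 1) * (e / (INR Q + 1)) by field; lra.
apply: Rmult_le_compat_r; lra.
Qed.

Definition separated (c : R) A : Prop := forall i j, A i = A j \/ c <= d (A i) (A j).

Lemma exists_separated A : exists n, separated (/ INR n.+1) A.
Proof.
have [||n hn] := @finite_uniform ('I_Q * 'I_Q)%type
    (fun ij n => A ij.1 = A ij.2 \/ / INR n.+1 <= d (A ij.1) (A ij.2)).
- by move=> ij n m /inv_INR_le nm []; [left|right; lra].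
- move=> [i j]; case: (classic (A i = A j)) => ij; first by exists 0%nat; left.
  have [n hn] := exists_inv_lt (rho_gt0 dM ij).
  by exists n; right; apply: Rlt_le.
by exists n => i j; apply: (hn (i, j)).
Qed.

End QPoints.

(** * Lipschitz selections and their extension to the closure *)

Definition closure (X : Type) (rho : X -> X -> R) (Z : X -> Prop) (x : X) : Prop :=
  forall e, 0 < e -> exists z, Z z /\ rho x z < e.

Section Selections.
Variables (X M : Type) (rho : X -> X -> R) (d : M -> M -> R) (Q : nat).
Hypotheses (rhoM : is_metric rho) (dM : is_metric d).

Lemma subset_closure (Z : X -> Prop) x : Z x -> closure rho Z x.
Proof. by move=> Zx e e0; exists x; rewrite (rho_refl rhoM). Qed.

Lemma closed_closure (Z : X -> Prop) : closed_set rho (closure rho Z).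
Proof.
move=> x nC; have [e h] := not_all_ex_not _ _ nC.
have [e0 {}h] := imply_to_and _ _ h.
exists (e / 2); split; first lra; move=> y; rewrite /ball => xy Cy; apply: h.
have e2 : 0 < e / 2 by lra.
have [z [Zz yz]] := Cy _ e2; exists z; split=> //.
have := rho_tri rhoM x y z; lra.
Qed.

(** The value at a closure point is the limit of [h] along points of [Z] at distance below
    [/ INR n.+1]. Comparing only with points of [Z] is enough: taking [z = x] gives agreement with
    [h] on [Z], and approximation gives the Lipschitz bound on the closure. *)
Lemma lipschitz_extension (Z : X -> Prop) (h : X -> M) (L : R) :
  complete_space d -> 0 <= L ->
  (forall x y, Z x -> Z y -> d (h x) (h y) <= L * rho x y) ->
  exists g, forall x z, closure rho Z x -> Z z -> d (g x) (h z) <= L * rho x z.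
Proof.
move=> cM L0 hL.
suff /functional_choice [g hg] : forall x, exists p,
    forall z, closure rho Z x -> Z z -> d p (h z) <= L * rho x z.
  by exists g => x z; apply: hg.
move=> x; case: (classic (closure rho Z x)) => Cx; last by exists (h x) => z /Cx.
have /functional_choice [w hw] n : exists z, Z z /\ rho x z < / INR n.+1.
  exact/Cx/inv_INR_gt0.
have [p hp] : exists p, seq_converges d (fun n => h (w n)) p.
  apply: cM => e e0.
  have e1 : 0 < e / (2 * L + 1) by apply: Rdiv_lt_0_compat; lra.
  have [N hN] := exists_inv_lt e1; exists N => m n Nm Nn.
  have [Zm xm] := hw m; have [Zn xn] := hw n.
  have := hL _ _ Zm Zn; have := rho_tri rhoM (w m) x (w n).
  rewrite (rho_sym rhoM (w m) x); have := inv_INR_le Nm; have := inv_INR_le Nn => ? ? ? ?.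
  have : L * rho (w m) (w n) <= L * (2 * (e / (2 * L + 1))).
    by apply: Rmult_le_compat_l => //; lra.
  have : e = (2 * L + 1) * (e / (2 * L + 1)) by field; lra.
  lra.
exists p => z _ Zz; apply: le_epsilon => e e0.
have e2 : 0 < e / 2 by lra.
have e1 : 0 < e / 2 / (L + 1) by apply: Rdiv_lt_0_compat; lra.
have [N hN] := hp _ e2; have [n hn] := exists_inv_lt e1.
have h1 := hN (maxn N n) (leq_maxl _ _).
have [Zw xw] := hw (maxn N n); have := inv_INR_le (leq_maxr N n) => ?.
have := hL _ _ Zw Zz; have := rho_tri dM p (h (w (maxn N n))) (h z).
have := rho_tri rhoM (w (maxn N n)) x z.
rewrite (rho_sym dM p (h (w (maxn N n)))) (rho_sym rhoM (w (maxn N n)) x) => h2 ? h3.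
have : L * rho (w (maxn N n)) z <= L * (e / 2 / (L + 1) + rho x z).
  by apply: Rmult_le_compat_l => //; lra.
have : e / 2 = (L + 1) * (e / 2 / (L + 1)) by field; lra.
lra.
Qed.

(* Close to [x0], a [dl]-separated Q-point has only one way of being matched
   with [f x0], up to permuting equal entries. *)
Lemma lipschitz_selection (f : X -> AQ M Q) (Z : X -> Prop) (L dl : R) (x0 : X) :
  Z x0 -> 0 < dl ->
  (forall x y, Z x -> Z y -> L * rho x y < dl / 4) ->
  (forall x y, Z x -> Z y -> close d (f x) (f y) (L * rho x y)) ->
  (forall x, Z x -> separated d dl (f x)) ->
  exists h : 'I_Q -> X -> M,
    (forall x, Z x -> eqAQ (f x) (fun i => h i x)) /\
    (forall i x y, Z x -> Z y -> d (h i x) (h i y) <= L * rho x y) /\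
    (forall i j x y, Z x -> Z y -> h i x = h j x -> h i y = h j y).
Proof.
move=> Z0 dl0 small cl sep.
have /functional_choice [s hs] : forall y, exists s : 'S_Q,
    Z y -> forall i, d (f x0 i) (f y (s i)) < dl / 4.
  move=> y; case: (classic (Z y)) => Zy; last by exists 1%g.
  have [s hs] := cl _ _ Z0 Zy; exists s => _ i.
  by have := hs i; have := small _ _ Z0 Zy; lra.
have uniq y a b : Z y -> d (f y a) (f y b) < dl -> f y a = f y b.
  by move=> Zy lt; case: (sep y Zy a b) => //; lra.
exists (fun i y => f y (s y i)); split; last split.
- by move=> x Zx; exists ((s x)^-1)%g => i; rewrite permKV.
- move=> i x y Zx Zy; have [t ht] := cl _ _ Zx Zy.
  (* Three distances below [dl / 4] separate these two entries of [f y], so separation makes them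
     equal and the Lipschitz matching [t] respects the labels fixed at [x0]. *)
  have <- : f y (t (s x i)) = f y (s y i); last exact: ht.
  apply: uniq => //; have := ht (s x i); have := hs x Zx i; have := hs y Zy i.
  have := small _ _ Zx Zy.
  have := rho_tri dM (f y (t (s x i))) (f x (s x i)) (f y (s y i)).
  have := rho_tri dM (f x (s x i)) (f x0 i) (f y (s y i)).
  by rewrite (rho_sym dM (f x (s x i)) (f x0 i)) (rho_sym dM (f y _) (f x _)); lra.
move=> i j x y Zx Zy e.
(* A coincidence at [x] is carried to the base point [x0] and from there to [y]. *)
have e0 : f x0 i = f x0 j.
  apply: uniq => //; have := hs x Zx i; have := hs x Zx j; rewrite -e.
  have := rho_tri dM (f x0 i) (f x (s x i)) (f x0 j).
  by rewrite (rho_sym dM (f x (s x i)) (f x0 j)); lra.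
apply: uniq => //; have := hs y Zy i; have := hs y Zy j; rewrite -e0.
have := rho_tri dM (f y (s y i)) (f x0 i) (f y (s y j)).
by rewrite (rho_sym dM (f y (s y i)) (f x0 i)); lra.
Qed.

(** The function [f] is arbitrary off the sets [E n], so the extensions can be compared with it only
    at closure points lying in some [E m]. Coincidences of selections pass to the closure because
    those on [Z] hold everywhere or nowhere. *)
Lemma lipschitz_selection_closure (f : X -> AQ M Q) (E : nat -> X -> Prop) (L r : nat -> R)
    (n : nat) (Z : X -> Prop) (dl : R) (x0 : X) :
  complete_space d ->
  (forall n m x, (n <= m)%nat -> E n x -> E m x) ->
  (forall n, 0 < r n) -> (forall n, 0 <= L n) ->
  (forall n x y, E n x -> E n y -> rho x y < r n -> close d (f x) (f y) (L n * rho x y)) ->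
  Z x0 -> 0 < dl -> (forall x, Z x -> E n x) ->
  (forall x y, Z x -> Z y -> rho x y < r n) ->
  (forall x y, Z x -> Z y -> L n * rho x y < dl / 4) ->
  (forall x, Z x -> separated d dl (f x)) ->
  exists g : 'I_Q -> X -> M,
    (forall i x y, closure rho Z x -> closure rho Z y -> d (g i x) (g i y) <= L n * rho x y) /\
    (forall m z, closure rho Z z -> E m z -> eqAQ (f z) (fun i => g i z)) /\
    (forall i j x y, Z x -> closure rho Z y -> g i x = g j x -> g i y = g j y).
Proof.
move=> cM Emono r0 L0 Elip Z0 dl0 ZE Zr ZL Zsep.
have [h [fh [hL hpat]]] := lipschitz_selection Z0 dl0 ZL
  (fun x y Zx Zy => Elip n x y (ZE x Zx) (ZE y Zy) (Zr x y Zx Zy)) Zsep.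
have /functional_choice [g hg] : forall i, exists g, forall x z, closure rho Z x -> Z z ->
    d (g x) (h i z) <= L n * rho x z.
  by move=> i; apply: lipschitz_extension => // x y; apply: hL.
have gh i z : Z z -> g i z = h i z.
  move=> Zz; apply: (rho_eq0 dM); apply: Rle_antisym; last exact: (rho_ge0 dM).
  have := hg i z z (subset_closure Zz) Zz; rewrite (rho_refl rhoM); lra.
have near x e : closure rho Z x -> 0 < e -> exists w, Z w /\ L n * rho x w <= e.
  move=> Cx e0; have e1 : 0 < e / (L n + 1) by apply: Rdiv_lt_0_compat => //; have := L0 n; lra.
  have [w [Zw xw]] := Cx _ e1; exists w; split=> //.
  have -> : e = (L n + 1) * (e / (L n + 1)) by field; have := L0 n; lra.
  have := Rmult_le_compat_l _ _ _ (L0 n) (Rlt_le _ _ xw); lra.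
exists g; split; last split.
- move=> i x y Cx Cy; apply: le_epsilon => e e0; have e2 : 0 < e / 2 by lra.
  have [w [Zw xw]] := near x _ Cx e2.
  have := hg i x w Cx Zw; have := hg i y w Cy Zw.
  have := Rmult_le_compat_l _ _ _ (L0 n) (rho_tri rhoM y x w).
  have := rho_tri dM (g i x) (h i w) (g i y).
  by rewrite (rho_sym dM (h i w)) (rho_sym rhoM y x); lra.
- move=> m z Cz Ez; apply: (eqAQ_of_close dM) => c c0.
  (* Both [z] and the approximating points of [Z] lie in [E p], where [f] is locally Lipschitz with
     constant [L p]. *)
  pose p := maxn m n.
  have L1 : 0 < L p + L n + 1 by have := L0 n; have := L0 p; lra.
  have c1 : 0 < c / (L p + L n + 1) by apply: Rdiv_lt_0_compat.
  have [w [Zw zw]] := Cz _ (Rmin_pos _ _ c1 (r0 p)).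
  have zw1 := Rlt_le_trans _ _ _ zw (Rmin_l _ _).
  have zw2 := Rlt_le_trans _ _ _ zw (Rmin_r _ _).
  have Ewp : E p w by apply: Emono (ZE w Zw); apply: leq_maxr.
  have Ezp : E p z by apply: Emono Ez; apply: leq_maxl.
  have c3 : close d (fun i => h i w) (fun i => g i z) (L n * rho z w).
    by apply: close_pointwise => i; rewrite (rho_sym dM); apply: hg.
  apply: close_mono (close_tri dM (Elip p z w Ezp Ewp zw2)
    (close_tri dM (eqAQ_close dM (fh w Zw)) c3)).
  have -> : c = (L p + L n + 1) * (c / (L p + L n + 1)) by field; lra.
  have := Rmult_le_compat_l _ _ _ (L0 n) (Rlt_le _ _ zw1).
  have := Rmult_le_compat_l _ _ _ (L0 p) (Rlt_le _ _ zw1); lra.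
move=> i j x y Zx Cy; rewrite (gh i x) // (gh j x) // => e.
apply: (rho_eq0 dM); apply: Rle_antisym; last exact: (rho_ge0 dM).
apply: le0_of_le_all_eps => c c0; have c2 : 0 < c / 2 by lra.
have [w [Zw yw]] := near y _ Cy c2.
have := hg i y w Cy Zw; have := hg j y w Cy Zw; rewrite (hpat i j x w) //.
have := rho_tri dM (g i y) (h j w) (g j y); rewrite (rho_sym dM (h j w)); lra.
Qed.

End Selections.

(** * Germs and differentiability *)

Section Differentiability.
Variables (X M : Type) (rho : X -> X -> R) (mu : (X -> Prop) -> Rbar) (K : R).
Variables (d : M -> M -> R) (Q : nat).
Hypothesis XD : doubling_mms rho mu K.
Hypothesis dM : is_metric d.

Let rhoM : is_metric rho. Proof. by case: XD => _ []. Qed.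
Let muO : outer_measure mu. Proof. by case: XD => _ [_ [_ [_ []]]]. Qed.

Implicit Types (b : bool) (x y z : X).

Lemma nbhd_True b x : nbhd rho mu b x (fun _ => True).
Proof.
have h : metric_nbhd rho x (fun _ => True) by split=> //; exists 1; split=> //; lra.
by case: b => //; apply: (metric_nbhd_mu XD h).
Qed.

Lemma nbhd_and b x (A B : X -> Prop) :
  nbhd rho mu b x A -> nbhd rho mu b x B -> nbhd rho mu b x (fun y => A y /\ B y).
Proof.
case: b => /=; first by move=> nA nB; apply: (mu_nbhd_and XD).
move=> [Ax [r [r0 rA]]] [Bx [s [s0 sB]]]; split=> //; exists (Rmin r s).
split; first exact: Rmin_pos.
rewrite /ball => y xy; split; [apply: rA|apply: sB]; apply: Rlt_le_trans xy _.
  exact: Rmin_l.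
exact: Rmin_r.
Qed.

Lemma nbhd_mono b x (A B : X -> Prop) :
  (forall y, A y -> B y) -> nbhd rho mu b x A -> nbhd rho mu b x B.
Proof.
case: b => /=; first exact: mu_nbhd_mono.
by move=> AB [/AB Bx [r [r0 rA]]]; split=> //; exists r; split=> // y /rA /AB.
Qed.

Lemma nbhd_forall b x (T : finType) (A : T -> X -> Prop) :
  (forall t, nbhd rho mu b x (A t)) -> nbhd rho mu b x (fun y => forall t, A t y).
Proof.
move=> hA; apply: (nbhd_mono (A := fun y => forall t, t \in enum T -> A t y)).
  by move=> y h t; apply: h; rewrite mem_enum.
elim: (enum T) => [|t s IH]; first by apply: (nbhd_mono _ (nbhd_True b x)).
apply: (nbhd_mono _ (nbhd_and (hA t) IH)) => y [At As] u.
by rewrite inE => /orP[/eqP ->|/As].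
Qed.

Lemma nbhd_borel b x (U : X -> Prop) : nbhd rho mu b x U ->
  exists W, borel rho W /\ nbhd rho mu b x W /\ forall y, W y -> U y.
Proof.
case: b => /= [[Ux [B [bB [BU h]]]]|[Ux [r [r0 rU]]]].
  (* The Borel core [B] of a [mu]-neighborhood may omit [x] itself, so the point is added. *)
  exists (fun y => y = x \/ B y); split.
    by apply: borel_or => //; apply: borel_closed; apply: closed_set1.
  split; last by move=> y [->|/BU].
  by split; [left|exists B; split=> //; split=> // y ?; right].
exists (ball rho x r); split; first exact: borel_ball.
by split=> //; split; [rewrite /ball (rho_refl rhoM)|exists r].
Qed.

Lemma accumulation_mu_nbhd b x (V : X -> Prop) :
  accumulation rho mu b (fun _ => True) x -> mu_nbhd rho mu x V ->
  exists y, V y /\ y <> x.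
Proof.
case: b => [acc /acc [y [Vy [_ yx]]]|acc nV]; first by exists y.
have half : 0 < / 2 by lra.
(* A point of [V] closer to [y] than half of [rho x y] cannot be [x]. *)
have [r [r0 hr]] := mu_nbhd_dense XD nV half.
have [|y [xy [_ yx]]] := acc (ball rho x r).
  by split; [rewrite /ball (rho_refl rhoM)|exists r].
have y0 : 0 < rho x y by apply: (rho_gt0 rhoM) => e; apply: yx.
have [z [Vz yz]] := hr y y0 xy; exists z; split=> // zx.
by move: yz; rewrite zx (rho_sym rhoM y x); lra.
Qed.

Lemma lim0_dist_le (N : Type) (e : N -> N -> R) b (S : X -> Prop) x (u v : X -> N) eps :
  lim0 rho mu b S x (fun y => e (u y) (v y) / rho y x) -> 0 < eps ->
  exists U, nbhd rho mu b x U /\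
    forall y, U y -> S y -> y <> x -> e (u y) (v y) <= eps * rho y x.
Proof.
move=> lim eps0; have [U [nU hU]] := lim eps eps0.
exists U; split=> // y Uy Sy yx; have y0 := rho_gt0 rhoM yx.
have := Rle_lt_trans _ _ _ (Rle_abs _) (hU y Uy Sy yx).
move=> /(Rmult_lt_compat_r _ _ _ y0); rewrite /Rdiv Rmult_assoc Rinv_l; last lra.
by rewrite Rmult_1_r => /Rlt_le.
Qed.

(** The germ is the tuple of the [Fs] on their common domain, and it serves as its own
    representative [G] in [DQ]. Equal entries of [f x] are given identical representatives, which
    makes the compatibility condition of [DQ] immediate. *)
Lemma DQ_differentiable b (D : X -> M -> germ_rep X M -> Prop) (f : X -> AQ M Q) x
    (Fs : 'I_Q -> germ_rep X M) :
  distribution rho mu d (@eq M) b D ->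
  accumulation rho mu b (fun _ => True) x ->
  (forall i, D x (f x i) (Fs i)) -> (forall i j, f x i = f x j -> Fs i = Fs j) ->
  (forall eps, 0 < eps -> exists U, nbhd rho mu b x U /\ forall y, U y -> y <> x ->
     (forall i, gdom (Fs i) y) ->
     close d (f y) (fun i => gfun (Fs i) y) (eps * rho y x)) ->
  differentiable_at rho mu (@Gdist M d Q) b (@DQ X M rho mu d Q b D) (fun _ => True) f x.
Proof.
move=> [Dval _] acc DFs Feq lim; split=> //; split=> //.
pose F := GermRep (fun y => forall i, gdom (Fs i) y) (fun y i => gfun (Fs i) y).
have Q0 := pos_INR Q.
have nF : nbhd rho mu b x (gdom F).
  by apply: nbhd_forall => i; case: (Dval _ _ _ (DFs i)).
have valF : valid_germ rho mu (@Gdist M d Q) (@eqAQ M Q) b x (f x) F.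
  split=> //; split; last first.
    by exists 1%g => i; rewrite perm1 /=; case: (Dval _ _ _ (DFs i)) => _ [].
  have [||n hn] := @finite_uniform 'I_Q (fun i n => forall y z, gdom (Fs i) y ->
      gdom (Fs i) z -> d (gfun (Fs i) y) (gfun (Fs i) z) <= INR n * rho y z).
  - move=> i n m /leP /le_INR nm h y z Fy Fz; apply: Rle_trans (h y z Fy Fz) _.
    exact/Rmult_le_compat_r/nm/(rho_ge0 rhoM).
  - move=> i; case: (Dval _ _ _ (DFs i)) => _ [[L [L0 hL]] _].
    have [n Ln] := exists_INR_ge L; exists n.+1 => y z Fy Fz.
    apply: Rle_trans (hL y z Fy Fz) _; exact/Rmult_le_compat_r/Ln/(rho_ge0 rhoM).
  exists (INR Q * INR n); split; first by apply: Rmult_le_pos => //; apply: pos_INR.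
  move=> y z Fy Fz; rewrite Rmult_assoc; apply: (close_Gdist dM).
    by apply: Rmult_le_pos; [apply: pos_INR|apply: (rho_ge0 rhoM)].
  by apply: close_pointwise => i; apply: hn.
have Gself (A : AQ M Q) : Gdist d A A = 0.
  apply: Rle_antisym; last exact: Gdist_ge0.
  have := close_Gdist dM (Rle_refl 0) (close_refl dM A (Rle_refl 0)); lra.
exists F; split; last first.
  (* Passing from [close] to [Gdist] costs a factor [INR Q]; the [+ 1] makes the resulting
     inequality strict. *)
  move=> eps eps0; have eps1 : 0 < eps / (INR Q + 1) by apply: Rdiv_lt_0_compat; lra.
  have [U [nU hU]] := lim _ eps1; exists U; split=> // y Uy [_ Fy] yx.
  have y0 := rho_gt0 rhoM yx.
  have c0 : 0 <= eps / (INR Q + 1) * rho y x by apply: Rlt_le; apply: Rmult_lt_0_compat.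
  have := close_Gdist dM c0 (hU y Uy yx Fy).
  rewrite Rabs_pos_eq; last by apply: Rle_mult_inv_pos => //; apply: Gdist_ge0.
  move=> le; apply: (Rmult_lt_reg_r _ _ _ y0); rewrite {1}/Rdiv Rmult_assoc Rinv_l; last lra.
  rewrite Rmult_1_r; apply: Rle_lt_trans le _.
  have {2}-> : eps = (INR Q + 1) * (eps / (INR Q + 1)) by field; lra.
  have : 0 < eps / (INR Q + 1) * rho y x by apply: Rmult_lt_0_compat.
  lra.
split=> //; exists Fs; split=> //; split.
  move=> i j /Feq -> eps eps0; exists (fun _ => True); split; first exact: nbhd_True.
  by move=> y _ _ _; rewrite (rho_refl dM) /Rdiv Rmult_0_l Rabs_R0.
exists F; split=> //; split.
  move=> eps eps0; exists (fun _ => True); split; first exact: nbhd_True.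
  by move=> y _ _ _; rewrite Gself /Rdiv Rmult_0_l Rabs_R0.
have [W [bW [nW WF]]] := nbhd_borel nF.
exists W; split=> //; split=> //; split=> [y /WF //|y _].
by exists 1%g => i; rewrite perm1.
Qed.

Lemma null_forall_fin (T : finType) (P : T -> X -> Prop) (S : X -> Prop) :
  (forall t, exists Z, mu Z = Finite 0 /\ forall x, S x -> ~ Z x -> P t x) ->
  exists Z, mu Z = Finite 0 /\ forall x, S x -> ~ Z x -> forall t, P t x.
Proof.
move=> /functional_choice [Z hZ].
exists (fun x => exists n, (if @unpickle T n is Some t then Z t else fun _ => False) x); split.
  apply: (null_cup muO) => n; case: unpickle => [t|]; last by case: muO.
  by case: (hZ t).
move=> x Sx nZ t; apply: (proj2 (hZ t)) => // Zx; apply: nZ.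
by exists (pickle t); rewrite pickleK.
Qed.

(** Completeness is applied on the density points of [S] within [C]. There the intersection is a
    [mu]-neighborhood, so accumulation points of the space are [mu]-accumulation points of [C], and
    the Lipschitz bound makes the upper limit finite. *)
Lemma ae_differentiable_closed b (D : X -> M -> germ_rep X M -> Prop) (S C : X -> Prop)
    (g : 'I_Q -> X -> M) (L : R) :
  differentiably_complete rho mu d D -> mu_measurable mu S ->
  (forall x, S x -> accumulation rho mu b (fun _ => True) x) ->
  (exists x, C x) -> closed_set rho C -> 0 <= L ->
  (forall i x y, C x -> C y -> d (g i x) (g i y) <= L * rho x y) ->
  exists Z, mu Z = Finite 0 /\ forall x, S x /\ C x -> ~ Z x ->
    mu_nbhd rho mu x (fun y => S y /\ C y) /\
    forall i, differentiable_at rho mu d true D C (g i) x.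
Proof.
move=> DC mS acc C0 cC L0 gL.
have mC : mu_measurable mu C.
  case: XD => _ [_ [_ [_ [_ [[h _] _]]]]]; apply: h; exact: borel_closed.
have mSC := measurable_and muO mS mC.
have null0 := lebesgue_density XD mSC.
set Z0 := (fun x => _) in null0.
have mS' := measurable_and muO mSC (measurable_compl (null_measurable muO null0)).
have S'nbhd x : (S x /\ C x) /\ ~ Z0 x -> mu_nbhd rho mu x (fun y => S y /\ C y).
  by move=> [SCx nZ]; apply: NNPP => h; apply: nZ.
have [Z1 [Z1null hZ1]] : exists Z, mu Z = Finite 0 /\ forall x, (S x /\ C x) /\ ~ Z0 x ->
    ~ Z x -> forall i, differentiable_at rho mu d true D C (g i) x.
  apply: null_forall_fin => i; apply: DC => //; first by exists L; split=> // y z; apply: gL.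
  move=> x hx; have [[Sx Cx] _] := hx; split=> //; split.
    move=> U nU; have [y [[Uy [_ Cy]] yx]] :=
      accumulation_mu_nbhd (acc x Sx) (mu_nbhd_and XD nU (S'nbhd x hx)).
    by exists y.
  exists (fun _ => True), L; split; first exact: nbhd_True.
  move=> y _ Cy yx; have y0 := rho_gt0 rhoM yx.
  apply: (Rmult_le_reg_r _ _ _ y0); rewrite /Rdiv Rmult_assoc Rinv_l; last lra.
  by rewrite Rmult_1_r; apply: gL.
exists (fun x => Z0 x \/ Z1 x); split; first exact: null_or.
move=> x SCx nZ; have hx : (S x /\ C x) /\ ~ Z0 x by split=> // h; apply: nZ; left.
split; first exact: S'nbhd.
by apply: hZ1 => // h; apply: nZ; right.
Qed.

(** Selections equal at [x] coincide on [C], so one germ serves all of them. Choosing it as a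
    function [phi] of the value gives equal entries the same representative; values not taken get a
    constant dummy. *)
Lemma common_germs (D : X -> M -> germ_rep X M -> Prop) (C : X -> Prop)
    (g : 'I_Q -> X -> M) x :
  (forall i j y, C y -> g i x = g j x -> g i y = g j y) ->
  (forall i, differentiable_at rho mu d true D C (g i) x) ->
  exists phi : M -> germ_rep X M, forall i, D x (g i x) (phi (g i x)) /\
    lim0 rho mu true (fun y => C y /\ gdom (phi (g i x)) y) x
      (fun y => d (g i y) (gfun (phi (g i x)) y) / rho y x).
Proof.
move=> pat diff.
suff /functional_choice [phi h] : forall p, exists F, forall i, g i x = p ->
    D x p F /\ lim0 rho mu true (fun y => C y /\ gdom F y) x
      (fun y => d (g i y) (gfun F y) / rho y x).
  by exists phi => i; apply: h.
move=> p; case: (classic (exists i, g i x = p)) => [[i <-]|no]; last first.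
  by exists (GermRep (fun _ => True) (fun _ => p)) => i e; case: no; exists i.
have [_ [_ [F [DF lim]]]] := diff i; exists F => j ji; split=> // eps eps0.
have [U [nU hU]] := lim eps eps0; exists U; split=> // y Uy [Cy Fy] yx.
by rewrite (pat j i y Cy ji); apply: hU.
Qed.

End Differentiability.

(** * Decomposition into Lipschitz pieces *)

Section Stepanoff.
Variables (X M : Type) (rho : X -> X -> R) (mu : (X -> Prop) -> Rbar) (K : R).
Variables (d : M -> M -> R) (Q : nat).
Hypothesis XD : doubling_mms rho mu K.
Hypothesis dM : is_metric d.
Hypothesis cM : complete_space d.

Let rhoM : is_metric rho. Proof. by case: XD => _ []. Qed.
Let muO : outer_measure mu. Proof. by case: XD => _ [_ [_ [_ []]]]. Qed.

(* In the approximate case the comparison holds on the [mu]-neighborhood where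
   [f] agrees with the extended selections [g]. *)
Lemma first_order_approximate (S C : X -> Prop) (f : X -> AQ M Q) (g : 'I_Q -> X -> M)
    (F : 'I_Q -> germ_rep X M) (s : 'S_Q) x :
  mu_nbhd rho mu x (fun y => S y /\ C y) ->
  (forall y, S y -> C y -> eqAQ (f y) (fun i => g i y)) ->
  (forall i, lim0 rho mu true (fun y => C y /\ gdom (F i) y) x
      (fun y => d (g i y) (gfun (F i) y) / rho y x)) ->
  forall eps, 0 < eps -> exists U, nbhd rho mu true x U /\ forall y, U y -> y <> x ->
    (forall i, gdom (F (s i)) y) ->
    close d (f y) (fun i => gfun (F (s i)) y) (eps * rho y x).
Proof.
move=> nSC fg lim eps eps0.
have /functional_choice [U hU] i := lim0_dist_le XD (lim i) eps0.
exists (fun y => (S y /\ C y) /\ forall i, U i y); split.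
  apply: (nbhd_and XD (b := true)) => //.
  by apply: (nbhd_forall XD (b := true)) => i; case: (hU i).
move=> y [[Sy Cy] Uy] yx Fy.
rewrite -[_ * _]Rplus_0_l; apply: (close_tri dM (eqAQ_close dM (fg y Sy Cy))).
exists (s^-1)%g => i; rewrite permKV; apply: (proj2 (hU i)) => //; split=> //.
by have := Fy ((s^-1)%g i); rewrite permKV.
Qed.

(* In the metric case the estimate on the [mu]-neighborhood [V] is carried to
   all nearby points [y] by a point [z] of [V] with [rho y z] much smaller than
   [rho x y]. *)
Lemma first_order_metric (S Z : X -> Prop) (f : X -> AQ M Q) (g : 'I_Q -> X -> M)
    (F : 'I_Q -> germ_rep X M) (s : 'S_Q) (L r : R) x :
  0 <= L -> 0 < r -> mu_nbhd rho mu x (fun y => S y /\ closure rho Z y) ->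
  (forall w y, Z w -> rho w y < r -> close d (f y) (f w) (L * rho w y)) ->
  (forall w, Z w -> eqAQ (f w) (fun i => g i w)) ->
  (forall i y z, closure rho Z y -> closure rho Z z -> d (g i y) (g i z) <= L * rho y z) ->
  (forall i, valid_germ rho mu d (@eq M) false x (g i x) (F i)) ->
  (forall i, lim0 rho mu true (fun y => closure rho Z y /\ gdom (F i) y) x
      (fun y => d (g i y) (gfun (F i) y) / rho y x)) ->
  forall eps, 0 < eps -> exists U, nbhd rho mu false x U /\ forall y, U y -> y <> x ->
    (forall i, gdom (F (s i)) y) ->
    close d (f y) (fun i => gfun (F (s i)) y) (eps * rho y x).
Proof.
move=> L0 r0 nSC fZ fg gL Fval lim eps eps0.
have [_ [t [t0 tF]]] : metric_nbhd rho x (fun y => forall i, gdom (F i) y).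
  by apply: (nbhd_forall XD (b := false)) => i; case: (Fval i).
have [||n Flip] := @finite_uniform 'I_Q (fun i n => forall y z, gdom (F i) y ->
    gdom (F i) z -> d (gfun (F i) y) (gfun (F i) z) <= INR n * rho y z).
- move=> i n m /leP /le_INR nm h y z Fy Fz; apply: Rle_trans (h y z Fy Fz) _.
  exact/Rmult_le_compat_r/nm/(rho_ge0 rhoM).
- move=> i; case: (Fval i) => _ [[Li [Li0 hL]] _].
  have [n Ln] := exists_INR_ge Li; exists n.+1 => y z Fy Fz.
  apply: Rle_trans (hL y z Fy Fz) _; exact/Rmult_le_compat_r/Ln/(rho_ge0 rhoM).
set A := INR n in Flip; have A0 : 0 <= A := pos_INR n.
(* In units of [eta * c], the path from [f y] to the germ at [y] costs [2 * L] from [y] to [w], [L]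
   from [w] to [z], 2 from [g] to the germ at [z], and [A] from [z] back to [y]. *)
pose eta := Rmin 1 (eps / (3 * L + 2 + A)).
have den : 0 < 3 * L + 2 + A by lra.
have eta0 : 0 < eta by apply: Rmin_pos; [lra|apply: Rdiv_lt_0_compat].
have eta1 : eta <= 1 := Rmin_l _ _.
have etaE : (3 * L + 2 + A) * eta <= eps.
  have -> : eps = (3 * L + 2 + A) * (eps / (3 * L + 2 + A)) by field; lra.
  by apply: Rmult_le_compat_l; [lra|apply: Rmin_r].
have /functional_choice [U hU] i := lim0_dist_le XD (lim i) eta0.
have nV : mu_nbhd rho mu x (fun y => (S y /\ closure rho Z y) /\ forall i, U i y).
  apply: (nbhd_and XD (b := true)) => //.
  by apply: (nbhd_forall XD (b := true)) => i; case: (hU i).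
have [dl [dl0 hdl]] := mu_nbhd_dense XD nV eta0.
(* The halves are needed since [z] may be at distance [2 * c] from [x] and [w] almost [2 * c] from
   [y]. *)
pose R0 := Rmin dl (Rmin (t / 2) (r / 2)).
have R00 : 0 < R0 by apply: Rmin_pos => //; apply: Rmin_pos; lra.
exists (ball rho x R0); split.
  by split; [rewrite /ball (rho_refl rhoM)|exists R0].
move=> y; rewrite /ball => xy yx Fy; rewrite (rho_sym rhoM y x).
have y0 : 0 < rho x y by apply: (rho_gt0 rhoM) => e; apply: yx.
have R1 : R0 <= dl := Rmin_l _ _.
have R2 : R0 <= t / 2 by apply: Rle_trans (Rmin_r _ _) (Rmin_l _ _).
have R3 : R0 <= r / 2 by apply: Rle_trans (Rmin_r _ _) (Rmin_r _ _).
have [z [[[_ Cz] Uz] yz]] := hdl y y0 (Rlt_le_trans _ _ _ xy R1).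
set c := rho x y in xy y0 yz *.
have etac : eta * c <= c by nra.
have etac0 : 0 < eta * c by apply: Rmult_lt_0_compat.
(* The point [z] lies only in the closure; [f] is controlled around points of [Z], so [w] is
   inserted. *)
have [w [Zw zw]] := Cz _ etac0.
have xz : rho x z <= 2 * c by have := rho_tri rhoM x y z; rewrite -/c; lra.
have zx : z <> x by move=> e; move: yz; rewrite e (rho_sym rhoM y x) -/c; lra.
have wy : rho w y < 2 * (eta * c).
  have := rho_tri rhoM w z y; rewrite (rho_sym rhoM w z) (rho_sym rhoM z y); lra.
have wr : rho w y < r by lra.
have Fz i : gdom (F i) z by apply: tF; rewrite /ball; lra.
have gz : close d (fun i => g i w) (fun i => g i z) (L * (eta * c)).
  apply: close_pointwise => i; rewrite (rho_sym dM).
  apply: Rle_trans (gL i z w Cz (subset_closure rhoM Zw)) _.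
  by apply: Rmult_le_compat_l => //; lra.
have gF : close d (fun i => g i z) (fun i => gfun (F (s i)) y) (2 * (eta * c) + A * (eta * c)).
  exists (s^-1)%g => i; rewrite permKV.
  have Fiy : gdom (F i) y by have := Fy ((s^-1)%g i); rewrite permKV.
  have h1 := proj2 (hU i) z (Uz i) (conj Cz (Fz i)) zx.
  have h2 := Flip i z y (Fz i) Fiy.
  have h3 : eta * rho z x <= eta * (2 * c).
    by apply: Rmult_le_compat_l; [lra|rewrite (rho_sym rhoM z x)].
  have h4 : A * rho z y <= A * (eta * c).
    by apply: Rmult_le_compat_l => //; rewrite (rho_sym rhoM z y); lra.
  have := rho_tri dM (g i z) (gfun (F i) z) (gfun (F i) y); lra.
have := close_tri dM (fZ w y Zw wr) (close_tri dM (eqAQ_close dM (fg w Zw))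
  (close_tri dM gz gF)).
apply: close_mono.
have : L * rho w y <= L * (2 * (eta * c)) by apply: Rmult_le_compat_l => //; lra.
have : ((3 * L + 2 + A) * eta) * c <= eps * c by apply: Rmult_le_compat_r => //; lra.
lra.
Qed.

(** Countably many pieces [Z n k] cover [S], so the non-differentiability points need only be null
    in each. The density argument runs on the measurable set of points of [S] in the closure [C],
    which contains the piece. *)
Lemma ae_differentiable_pieces (b : bool) (D : X -> M -> germ_rep X M -> Prop)
    (S : X -> Prop) (f : X -> AQ M Q) (E : nat -> X -> Prop) (L r : nat -> R) :
  distribution rho mu d (@eq M) b D -> differentiably_complete rho mu d D ->
  mu_measurable mu S ->
  (forall x, S x -> accumulation rho mu b (fun _ => True) x) ->
  (forall n m x, (n <= m)%nat -> E n x -> E m x) ->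
  (forall n, 0 < r n) -> (forall n, 0 <= L n) ->
  (forall n x y, E n x -> E n y -> rho x y < r n -> close d (f x) (f y) (L n * rho x y)) ->
  (forall x, S x <-> exists n, E n x) ->
  (b = false -> forall n w y, E n w -> rho w y < r n ->
     close d (f y) (f w) (L n * rho w y)) ->
  exists Z, mu Z = Finite 0 /\ forall x, S x -> ~ Z x ->
    differentiable_at rho mu (@Gdist M d Q) b (@DQ X M rho mu d Q b D) (fun _ => True) f x.
Proof.
move=> Ddist DC mS acc Emono r0 L0 Elip SE metric.
set diff := differentiable_at _ _ _ _ _ _ _.
case: (classic (exists x : X, True)) => [[p _]|noX]; last first.
  by exists (fun _ => False); split; [case: muO|move=> x; case: noX; exists x].
have [q qd] := exists_dense_seq XD p.
exists (fun x => S x /\ ~ diff x); split; last by move=> x Sx nZ; apply: NNPP => h; apply: nZ.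
(* Points of a piece are less than [2 * t n] apart: close enough for the local Lipschitz bound and
   for the [dl / 4] smallness with [dl = / INR n.+1]. *)
pose t n := Rmin (r n) (/ INR n.+1 / 4 / (L n + 1)) / 2.
have t0 n : 0 < t n.
  apply: Rmult_lt_0_compat; last lra; apply: Rmin_pos => //.
  by apply: Rdiv_lt_0_compat; have := L0 n; have := inv_INR_gt0 n; lra.
pose Z n k x := E n x /\ separated d (/ INR n.+1) (f x) /\ rho x (q k) < t n.
apply: (null_mono muO (B := fun x => exists n k, Z n k x /\ ~ diff x)).
  move=> x [/SE [n1 En1] ndiff]; have [n2 sep2] := exists_separated dM (f x).
  exists (maxn n1 n2); have [k hk] := qd x _ (t0 (maxn n1 n2)); exists k; split=> //.
  split; first by apply: Emono En1; apply: leq_maxl.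
  split=> // i j; case: (sep2 i j); first by left.
  by have := inv_INR_le (leq_maxr n1 n2); right; lra.
apply: (null_cup muO) => n; apply: (null_cup muO) => k.
case: (classic (exists x, Z n k x)) => [[x0 Zx0]|Z0]; last first.
  apply: (null_mono muO (B := fun _ => False)); last by case: muO.
  by move=> x [Zx _]; apply: Z0; exists x.
have Zdist x y : Z n k x -> Z n k y -> rho x y < 2 * t n.
  move=> [_ [_ xq]] [_ [_ yq]]; have := rho_tri rhoM x (q k) y.
  by rewrite (rho_sym rhoM (q k) y); lra.
have Zr x y : Z n k x -> Z n k y -> rho x y < r n.
  by move=> Zx Zy; have := Zdist x y Zx Zy; have := Rmin_l (r n) (/ INR n.+1 / 4 / (L n + 1));
    rewrite /t; lra.
have ZL x y : Z n k x -> Z n k y -> L n * rho x y < / INR n.+1 / 4.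
  move=> Zx Zy; have := Zdist x y Zx Zy.
  have := Rmin_r (r n) (/ INR n.+1 / 4 / (L n + 1)); rewrite /t => h1 h2.
  have lt : rho x y < / INR n.+1 / 4 / (L n + 1) by lra.
  have := Rmult_lt_compat_l (L n + 1) _ _ ltac:(have := L0 n; lra) lt.
  have -> : (L n + 1) * (/ INR n.+1 / 4 / (L n + 1)) = / INR n.+1 / 4.
    by field; split; first [by apply: not_0_INR | have := L0 n; lra].
  have := rho_ge0 rhoM x y; lra.
have ZE x : Z n k x -> E n x by case.
have Zsep x : Z n k x -> separated d (/ INR n.+1) (f x) by case=> _ [].
have [g [gL [fg gpat]]] := lipschitz_selection_closure rhoM dM cM Emono r0 L0 Elip
  Zx0 (inv_INR_gt0 n) ZE Zr ZL Zsep.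
set C := closure rho (Z n k) in gL fg gpat.
have SZ x : Z n k x -> S x by move=> /ZE En; apply/SE; exists n.
have ZC x : Z n k x -> C x by apply: (subset_closure rhoM).
have [N [N0 hN]] := ae_differentiable_closed XD DC mS acc
  (ex_intro _ x0 (ZC _ Zx0)) (closed_closure rhoM (Z := Z n k)) (L0 n) gL.
apply: (null_mono muO (B := N)) => // x [Zx ndiff]; apply: NNPP => nN; apply: ndiff.
have [nSC gdiff] := hN x (conj (SZ x Zx) (ZC x Zx)) nN.
have [phi hphi] := common_germs (fun i j y Cy => gpat i j x y Zx Cy) gdiff.
have fgS y : S y -> C y -> eqAQ (f y) (fun i => g i y).
  by move=> /SE [m Em] Cy; apply: fg Em.
(* The permutation [s] translates the labels of [f x] into those of the selections. *)
have [s hs] := fgS x (SZ x Zx) (ZC x Zx).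
apply: (DQ_differentiable XD dM (Fs := fun i => phi (g (s i) x)) Ddist (acc x (SZ x Zx))).
- by move=> i; rewrite hs; case: (hphi (s i)).
- by move=> i j; rewrite !hs => ->.
have lim i := proj2 (hphi i).
case: b {diff} Ddist acc metric hphi => Ddist acc metric hphi.
  exact: (first_order_approximate s nSC fgS lim).
apply: (first_order_metric s (L0 n) (r0 n) nSC _ _ gL _ lim).
- by move=> w y /ZE; apply: metric.
- by move=> w Zw; apply: fgS; [apply: SZ|apply: ZC].
by move=> i; apply: (proj1 Ddist); case: (hphi i).
Qed.

Lemma close_quotient (f : X -> AQ M Q) (x y : X) (l : R) :
  y <> x -> Gdist d (f y) (f x) / rho y x <= l -> close d (f y) (f x) (l * rho y x).
Proof.
move=> yx le; apply: close_mono (Gdist_close dM _ _).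
have y0 := rho_gt0 rhoM yx; have := Rmult_le_compat_r _ _ _ (Rlt_le _ _ y0) le.
by rewrite /Rdiv Rmult_assoc Rinv_l ?Rmult_1_r //; lra.
Qed.

Lemma pointwise_lipschitz_close (b : bool) (f : X -> AQ M Q) (x : X) :
  limsup_finite rho mu b (fun _ => True) x (fun y => Gdist d (f y) (f x) / rho y x) ->
  exists U l, nbhd rho mu b x U /\ 0 <= l /\
    forall y, U y -> close d (f y) (f x) (l * rho y x).
Proof.
move=> [U [l [nU hU]]]; exists U, (Rmax 0 l); split=> //; split; first exact: Rmax_l.
move=> y Uy; case: (classic (y = x)) => [->|yx].
  by rewrite (rho_refl rhoM) Rmult_0_r; apply: (close_refl dM); lra.
apply: close_quotient => //; apply: Rle_trans (Rmax_r _ _); exact: hU.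
Qed.

Theorem ae_DQ_differentiable_metric (D : X -> M -> germ_rep X M -> Prop) (f : X -> AQ M Q) :
  distribution rho mu d (@eq M) false D -> differentiably_complete rho mu d D ->
  ae_differentiable rho mu (@Gdist M d Q) false (@DQ X M rho mu d Q false D)
    (fun _ => True) f.
Proof.
move=> Ddist DC S mS SA.
(* Here [y] ranges over the whole ball, not only over [E n], which is what the metric comparison
   requires. *)
pose E n x := S x /\ forall y, rho x y < / INR n.+1 ->
  close d (f y) (f x) (INR n.+1 * rho x y).
have INR0 n : 0 <= INR n.+1 by apply: pos_INR.
apply: (ae_differentiable_pieces (E := E) (L := fun n => INR n.+1) (r := fun n => / INR n.+1)
  Ddist DC mS) => //.
- by move=> x /SA [_ []].
- move=> n m x nm [Sx h]; split=> // y xy.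
  apply: close_mono (h y (Rlt_le_trans _ _ _ xy (inv_INR_le nm))).
  by apply: Rmult_le_compat_r; [apply: (rho_ge0 rhoM)|apply: le_INR; apply/leP; rewrite ltnS].
- exact: inv_INR_gt0.
- by move=> n x y [_ h] _ xy; apply: (close_sym dM); apply: h.
- move=> x; split=> [Sx|[n []] //].
  have [_ [_ /pointwise_lipschitz_close [U [l [[_ [t [t0 tU]]] [l0 hU]]]]]] := SA x Sx.
  have [n1 h1] := exists_inv_lt t0; have [n2 h2] := exists_INR_ge l.
  exists (maxn n1 n2); split=> // y xy.
  have := hU y (tU y _); rewrite /ball (rho_sym rhoM y x) => /(_ _) h.
  have := inv_INR_le (leq_maxl n1 n2) => h3.
  apply: close_mono (h ltac:(lra)); apply: Rmult_le_compat_r; first exact: (rho_ge0 rhoM).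
  by apply: Rle_trans h2 _; apply: le_INR; apply/leP; rewrite ltnS leq_maxr.
by move=> _ n w y [_ h] wy; apply: h.
Qed.

Lemma vol_ball_shift (x z : X) : 0 < rho x z ->
  vol mu (ball rho z (2 * rho x z)) <= K ^ 2 * vol mu (ball rho x (rho x z)).
Proof.
move=> c0; apply: Rle_trans (vol_doubling_iter XD 2 x c0).
have c4 : 0 < 2 ^ 2 * rho x z by lra.
apply: (vol_mono XD (p := x) c4) => // y; rewrite /ball => zy.
by have := rho_tri rhoM x z y; lra.
Qed.

Theorem ae_DQ_differentiable_approximate (D : X -> M -> germ_rep X M -> Prop)
    (f : X -> AQ M Q) :
  distribution rho mu d (@eq M) true D -> differentiably_complete rho mu d D ->
  ae_differentiable rho mu (@Gdist M d Q) true (@DQ X M rho mu d Q true D)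
    (fun _ => True) f.
Proof.
move=> Ddist DC S mS SA; have K0 : 0 < K by case: XD.
have K2 : 0 < K ^ 2 by apply: pow_lt.
(* At distance [c], the bad points of [x] and [z] in their balls of radius [2 * c] have total volume
   at most [e0 * (K + K ^ 2)] times that of [ball rho x c], that is, half of it. *)
pose e0 := / (2 * (K + K ^ 2)).
have e00 : 0 < e0 by apply: Rinv_0_lt_compat; lra.
pose bad n x y := ~ close d (f y) (f x) (INR n.+1 * rho y x).
(* The bad set of an arbitrary [f] may be nonmeasurable; monotonicity and subadditivity of the outer
   measure suffice for it. *)
pose E n x := S x /\ forall r, 0 < r -> r < / INR n.+1 ->
  vol mu (fun y => ball rho x r y /\ bad n x y) <= e0 * vol mu (ball rho x r).
have INR0 n : 0 <= INR n.+1 by apply: pos_INR.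
have badmono n m x y : (n <= m)%nat -> bad m x y -> bad n x y.
  move=> nm bm cl; apply: bm; apply: close_mono cl; apply: Rmult_le_compat_r.
    exact: (rho_ge0 rhoM).
  by apply: le_INR; apply/leP; rewrite ltnS.
(* The good intermediate point is within [c] of [x] and [2 * c] of [z], hence the factor 3; the
   halved radius keeps [2 * c] below [/ INR n.+1]. *)
apply: (ae_differentiable_pieces (E := E) (L := fun n => 3 * INR n.+1)
  (r := fun n => / INR n.+1 / 2) Ddist DC mS) => //.
- by move=> x /SA [_ []].
- move=> n m x nm [Sx h]; split=> // r r0 rm.
  apply: Rle_trans (h r r0 (Rlt_le_trans _ _ _ rm (inv_INR_le nm))).
  apply: (vol_mono XD (p := x) r0) => [y []//|y [xy bm]]; split=> //.
  exact: badmono bm.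
- by move=> n; have := inv_INR_gt0 n; lra.
- by move=> n; have := INR0 n; lra.
- move=> n x z [_ hx] [_ hz] xz.
  case: (classic (x = z)) => [<-|xz'].
    by rewrite (rho_refl rhoM) Rmult_0_r; apply: (close_refl dM); lra.
  have c0 := rho_gt0 rhoM xz'; set c := rho x z in xz c0 *.
  have c2 : 0 < 2 * c by lra.
  have [y [xy [gx gz]]] : exists y, rho x y < c /\ ~ bad n x y /\ ~ bad n z y.
    apply: NNPP => no.
    have v0 := vol_ball_gt0 XD x c0.
    have c4 : 0 < 4 * c by lra.
    have sub : vol mu (ball rho x c) <=
        vol mu (fun y => ball rho x (2 * c) y /\ bad n x y) +
        vol mu (fun y => ball rho z (2 * c) y /\ bad n z y).
      apply: (vol_sub2 XD (p := x) c4) => [y []|y []|y].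
      - by rewrite /ball; lra.
      - by rewrite /ball => zy _; have := rho_tri rhoM x z y; rewrite -/c; lra.
      rewrite /ball => xy; case: (classic (bad n x y)) => bx; first by left; split=> //; lra.
      case: (classic (bad n z y)) => bz; last by case: no; exists y.
      by right; split=> //; have := rho_tri rhoM z x y; rewrite (rho_sym rhoM z x) -/c; lra.
    have h1 := hx _ c2 ltac:(lra); have h2 := hz _ c2 ltac:(lra).
    have h3 := vol_doubling XD x c0; have h4 := vol_ball_shift c0; rewrite -/c in h4.
    have := Rmult_le_compat_l _ _ _ (Rlt_le _ _ e00) h3.
    have := Rmult_le_compat_l _ _ _ (Rlt_le _ _ e00) h4.
    have : e0 * (K ^ 2 * vol mu (ball rho x c)) + e0 * (K * vol mu (ball rho x c)) =
      vol mu (ball rho x c) / 2 by rewrite /e0; field; lra.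
    lra.
  have {}gx := NNPP _ gx; have {}gz := NNPP _ gz.
  apply: close_mono (close_tri dM (close_sym dM gx) gz).
  have := rho_tri rhoM y x z; rewrite (rho_sym rhoM y x) -/c => yz.
  have := Rmult_le_compat_l _ _ _ (INR0 n) (Rlt_le _ _ xy).
  have : INR n.+1 * rho y z <= INR n.+1 * (2 * c) by apply: Rmult_le_compat_l => //; lra.
  lra.
move=> x; split=> [Sx|[n []] //].
have [_ [_ /pointwise_lipschitz_close [U [l [/(mu_nbhdP XD) [_ [B [bB [BU dB]]]] [l0 hU]]]]]] := SA x Sx.
(* Bad points of [x] avoid the Borel core [B] once [INR n.+1] exceeds [l], so density of [B] bounds
   their volume. *)
have [dl [dl0 hdl]] := dB _ e00.
have [n1 h1] := exists_inv_lt dl0; have [n2 h2] := exists_INR_ge l.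
exists (maxn n1 n2); split=> // r r0 rn; have h3 := inv_INR_le (leq_maxl n1 n2).
apply: Rle_trans (hdl r r0 ltac:(lra)).
apply: (vol_mono XD (p := x) r0) => [y []//|y [xy by_]]; split=> // By; apply: by_.
apply: close_mono (hU y (BU y By)); apply: Rmult_le_compat_r; first exact: (rho_ge0 rhoM).
by apply: Rle_trans h2 _; apply: le_INR; apply/leP; rewrite ltnS leq_maxr.
Qed.

End Stepanoff.

Theorem theorem3p4 (X : Type) (rho : X -> X -> R) (mu : (X -> Prop) -> Rbar)
    (K : R) (M : Type) (d : M -> M -> R) (Q : nat) :
  doubling_mms rho mu K ->
  is_metric d -> complete_space d ->
  (1 <= Q)%nat ->
  (* (a) *)
  (forall D : X -> M -> germ_rep X M -> Prop,
     distribution rho mu d (@eq M) false D ->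
     differentiably_complete rho mu d D ->
     forall f : X -> AQ M Q,
       ae_differentiable rho mu (@Gdist M d Q) false (@DQ X M rho mu d Q false D)
         (fun _ => True) f) /\
  (* (b) *)
  (forall D : X -> M -> germ_rep X M -> Prop,
     distribution rho mu d (@eq M) true D ->
     differentiably_complete rho mu d D ->
     forall f : X -> AQ M Q,
       ae_differentiable rho mu (@Gdist M d Q) true (@DQ X M rho mu d Q true D)
         (fun _ => True) f).
Proof.
move=> XD dM cM _; split=> D Ddist DC f.
  exact: (ae_DQ_differentiable_metric XD dM cM Ddist DC).
exact: (ae_DQ_differentiable_approximate XD dM cM Ddist DC).
Qed.
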